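(* Let $m\ge2$, $N\ge2$, $M=mN$, and consider the periodic Bogoyavlensky lattice $\dot z_k=z_k\big(\sum_{j=1}^{m-1}z_{k+j}-\sum_{j=1}^{m-1}z_{k-j}\big)$, $k\in\mathbb{Z}/M\mathbb{Z}$. Write $v^{(j)}_k=z_{m(k-1)+j}$ ($j=1,\dots,m$, $k$ mod $N$), so that the lattice reads $\dot v^{(j)}_k=v^{(j)}_k\Big(\sum_{i=j+1}^m\big(v^{(i)}_k-v^{(i)}_{k-1}\big)+\sum_{i=1}^{j-1}\big(v^{(i)}_{k+1}-v^{(i)}_k\big)\Big)$. Define the $N\times N$ matrices (indices mod $N$) $V_j(\lambda)=I+\lambda^{-1}\sum_{k=1}^Nv^{(j)}_kE_{k,k+1}$ ($j=1,\dots,m$), $U_1(\lambda)=\lambda\sum_{k=1}^NE_{k+1,k}+\sum_{k=1}^Nv^{(1)}_kE_{kk}$, and for $1\le j\le m$ $L_j(v^{(1)},\dots,v^{(m)},\lambda)=V_j(\lambda)\cdots V_2(\lambda)\,U_1(\lambda)\,V_m(\lambda)\cdots V_{j+1}(\lambda)$ (so $L_1=U_1V_m\cdots V_2$ and $L_m=V_m\cdots V_2U_1$). Let $T(z,\lambda)=\lambda^{-m+1}\sum_{k=1}^Mz_kE_{k,k+m-1}+\lambda\sum_{k=1}^ME_{k+1,k}$ be the $M\times M$ matrix (indices mod $M$). Then: (1) for each $1\le j\le m$, the set of all matrices $L_j(v^{(1)},\dots,v^{(m)},\lambda)$ is a Poisson submanifold of $g$ equipped with PB$(A,B,C,D)$;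 (2) along solutions of the lattice, $\dot L_j=[L_j,R(L_j)]$ for every $1\le j\le m$; (3) $\det(T^m(z,\lambda)-\mu I_M)=\prod_{j=1}^m\det\big(L_j(v^{(1)},\dots,v^{(m)},\lambda^m)-\mu I_N\big)$, and all the factors in this product are equal to each other.
   Context: $E_{ij}$ are matrix units. $g$ is the twisted loop algebra of formal Laurent series $u(\lambda)=\sum_{p\le p_0}\sum_{i-j\equiv p\ (\mathrm{mod}\ N)}\lambda^pu^{(p)}_{ij}E_{ij}$ ($N\times N$ matrices, finitely many positive powers of $\lambda$) with form $\langle u,v\rangle=\mathrm{tr}(u(\lambda)v(\lambda))_0$ (coefficient of $\lambda^0$). $g_k$: elements containing only $\lambda^k$ ($g_0$ = diagonal matrices); $g_\pm=\bigoplus_{\pm k>0}g_k$; $P_+,P_-,P_0$ projections onto $g_+,g_-,g_0$; $R_0=P_+-P_-$; $\Pi(E_{jj})=\sum_k\pi_{jk}E_{kk}$ with $\pi_{jk}=1$ ($j>k$), $-1$ ($j<k$), $0$ ($j=k$), extended as $\Pi\circ P_0$; $A=\frac12(R_0+\Pi)$, $D=\frac12(R_0-\Pi)$, $B=\frac12(P_0-\Pi)$, $C=\frac12(P_0+\Pi)$, $R=\frac12(R_0+P_0)$. For smooth $\varphi$ on $g$: $\nabla\varphi$ is the gradient w.r.t. $\langle\cdot,\cdot\rangle$, $d\varphi(u)=u\nabla\varphi(u)$, $d'\varphi(u)=\nabla\varphi(u)u$; PB$(A,B,C,D)$ is $\{\varphi,\psi\}(u)=\langle A(d'\varphi),d'\psi\rangle-\langle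 D(d\varphi),d\psi\rangle+\langle B(d\varphi),d'\psi\rangle-\langle C(d'\varphi),d\psi\rangle$. A Poisson submanifold is one to which all Hamiltonian vector fields of the bracket are tangent.
   Formalization: In (1) the set of L_j need not be a smooth submanifold (fails at v=0 for m=N=2), so (1) is stated as: at every v each Hamiltonian vector at L_j lies in the image of the differential of v -> L_j(v). Scalars are real, and (3) is stated for all real λ≠0 and μ. *)

(* Defs.v *)
From HB Require Import structures.
From mathcomp Require Import all_boot all_order all_algebra.
From mathcomp Require Import all_classical all_reals all_analysis.
Set Implicit Arguments. Unset Strict Implicit. Unset Printing Implicit Defensive.
Import Order.TTheory GRing.Theory Num.Theory.
Import numFieldNormedType.Exports.
Local Open Scope ring_scope.

(* Formal Laurent series in lambda with N x N matrix coefficients:          *)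
(*   u(lambda) = sum_p lambda^p (u p).                                       *)
(* Zero-based indices: row/column k : 'I_N stands for k+1 in the paper.     *)
Definition ser (R : realType) (n : nat) := int -> 'M[R]_n.

(* Membership in the twisted loop algebra g, with an explicit upper bound t *)
(* for the powers of lambda that occur:  u p = 0 for p > t, and the entry   *)
(* (i,l) of u p vanishes unless i - l = p (mod n).                           *)
Definition in_g (R : realType) (n : nat) (t : int) (u : ser R n) : Prop :=
  (forall p : int, t < p -> u p = 0) /\
  (forall (p : int) (i l : 'I_n), ~~ (n%:Z %| (i%:Z - l%:Z - p))%Z -> u p i l = 0).

(* Product of Laurent series u, v vanishing above the powers tu, tv:        *)
(*   (u v)_p = sum_{p - tv <= a <= tu} u_a v_{p-a}   (a finite sum).        *)
Definition mulS (R : realType) (n : nat) (tu tv : int) (u v : ser R n) : ser R n :=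
  fun p => if p <= tu + tv then
             \sum_(k < (absz (tu + tv - p)%R).+1) (u (tu - k%:Z) *m v (p - tu + k%:Z))
           else 0.

Definition addS (R : realType) (n : nat) (u v : ser R n) : ser R n := fun p => u p + v p.
Definition subS (R : realType) (n : nat) (u v : ser R n) : ser R n := fun p => u p - v p.
Definition halfS (R : realType) (n : nat) (u : ser R n) : ser R n := fun p => 2^-1 *: u p.
Definition oneS (R : realType) (n : nat) : ser R n := fun p => if p == 0 then 1%:M else 0.

Definition Pplus (R : realType) (n : nat) (u : ser R n) : ser R n :=
  fun p => if 0 < p then u p else 0.
Definition Pminus (R : realType) (n : nat) (u : ser R n) : ser R n :=
  fun p => if p < 0 then u p else 0.
Definition Pzero (R : realType) (n : nat) (u : ser R n) : ser R n :=
  fun p => if p == 0 then u p else 0.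
Definition R0op (R : realType) (n : nat) (u : ser R n) : ser R n :=
  subS (Pplus u) (Pminus u).

Definition piC (R : realType) (n : nat) (j k : 'I_n) : R :=
  if (k < j)%N then 1 else if (j < k)%N then -1 else 0.

(* Pi(E_jj) = sum_k pi_{jk} E_kk, extended as Pi o P_0 (the degree-0 part of *)
(* an element of g is diagonal; Pi acts on its diagonal entries).           *)
Definition PiOp (R : realType) (n : nat) (u : ser R n) : ser R n :=
  fun p => if p == 0 then
             \matrix_(i, l) (if i == l then \sum_(j < n) u 0 j j * @piC R n j l else 0)
           else 0.

Definition Aop (R : realType) (n : nat) (u : ser R n) := halfS (addS (R0op u) (PiOp u)).
Definition Dop (R : realType) (n : nat) (u : ser R n) := halfS (subS (R0op u) (PiOp u)).
Definition Bop (R : realType) (n : nat) (u : ser R n) := halfS (subS (Pzero u) (PiOp u)).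
Definition Cop (R : realType) (n : nat) (u : ser R n) := halfS (addS (Pzero u) (PiOp u)).
Definition Rop (R : realType) (n : nat) (u : ser R n) := halfS (addS (R0op u) (Pzero u)).

(* Hamiltonian vector field of PB(A,B,C,D) at u (u vanishing above tu) for  *)
(* a function phi with gradient X = grad phi(u) (X vanishing above tX).     *)
(* With d phi = u X, d' phi = X u, and Y = grad psi(u), the bracket is      *)
(*   {phi,psi}(u) = < u A(Xu) - D(uX) u + u B(uX) - C(Xu) u , Y >,           *)
(* so the Hamiltonian vector field of phi at u is                          *)
(*   u A(Xu) - D(uX) u + u B(uX) - C(Xu) u.                                  *)
Definition hamVF (R : realType) (n : nat) (tu tX : int) (u X : ser R n) : ser R n :=
  let uX := mulS tu tX u X in
  let Xu := mulS tX tu X u in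
  let t := tu + tX in
  subS (addS (subS (mulS tu t u (Aop Xu)) (mulS t tu (Dop uX) u))
             (mulS tu t u (Bop uX)))
       (mulS t tu (Cop Xu) u).

Definition commS (R : realType) (n : nat) (tu tv : int) (u v : ser R n) : ser R n :=
  subS (mulS tu tv u v) (mulS tv tu v u).

Definition evalS (R : realType) (n : nat) (u : ser R n) (lo hi : int) (x : R) : 'M[R]_n :=
  \sum_(k < (absz (hi - lo)%R).+1) (x ^ (lo + k%:Z)) *: u (lo + k%:Z).

(* The Lax matrices.  The variables v^{(j)}_k (j = 1..m, k = 1..N) are       *)
(* stored in an m x N matrix V with V (j-1) (k-1) = v^{(j)}_k.              *)

(* v^{(i)}_k for a 1-based index i (and 0 for i out of range, never used). *)
Definition vrow (R : realType) (m N : nat) (V : 'M[R]_(m, N)) (i : nat) (k : 'I_N) : R :=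
  match @insub nat (fun a => (a < m)%N) 'I_m i.-1 with Some j => V j k | None => 0 end.

Definition Vser (R : realType) (m N : nat) (V : 'M[R]_(m, N)) (i : nat) : ser R N :=
  fun p => if p == 0 then 1%:M
           else if p == -1 then
             \matrix_(k, l) (if (l : nat) == ((k : nat).+1 %% N)%N then vrow V i k else 0)
           else 0.

Definition U1ser (R : realType) (m N : nat) (V : 'M[R]_(m, N)) : ser R N :=
  fun p => if p == 1 then
             \matrix_(k, l) (if (k : nat) == ((l : nat).+1 %% N)%N then 1 else 0)
           else if p == 0 then
             \matrix_(k, l) (if k == l then vrow V 1 k else 0)
           else 0.

Definition prodV (R : realType) (m N : nat) (V : 'M[R]_(m, N)) (s : seq nat) : ser R N :=
  foldr (fun i acc => mulS 0 0 (Vser V i) acc) (@oneS R N) s.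

Definition Lser (R : realType) (m N : nat) (j : nat) (V : 'M[R]_(m, N)) : ser R N :=
  mulS 1 0 (mulS 0 1 (prodV V (rev (iota 2 j.-1))) (U1ser V))
           (prodV V (rev (iota j.+1 (m - j)))).

(* L_j evaluated at lambda = x (its powers of lambda lie in -(m-1)..1). *)
Definition Leval (R : realType) (m N : nat) (j : nat) (V : 'M[R]_(m, N)) (x : R) : 'M[R]_N :=
  evalS (Lser j V) (- (m%:Z)) 1 x.

(* The Bogoyavlensky lattice, z_k with k mod M (zero-based: z_0..z_{M-1}).  *)
Definition at_mod (R : realType) (M : nat) (z : 'I_M -> R) (a : nat) : R :=
  match @insub nat (fun b => (b < M)%N) 'I_M (a %% M)%N with Some i => z i | None => 0 end.

Definition bogo_rhs (R : realType) (m M : nat) (z : 'I_M -> R) (k : 'I_M) : R :=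
  z k * (\sum_(1 <= i < m) at_mod z (k + i)%N - \sum_(1 <= i < m) at_mod z (k + M - i)%N).

(* v^{(j)}_k = z_{m(k-1)+j}; zero-based: V (j-1) (k-1) = z (m (k-1) + (j-1)). *)
Definition Vof (R : realType) (m N : nat) (z : 'I_(m * N) -> R) : 'M[R]_(m, N) :=
  \matrix_(j, k) at_mod z (m * k + j)%N.

Definition Tmat (R : realType) (m M : nat) (z : 'I_M -> R) (x : R) : 'M[R]_M :=
  \matrix_(i, l) ((if (l : nat) == ((i + m.-1) %% M)%N then x ^- m.-1 * z i else 0)
                  + (if (i : nat) == ((l : nat).+1 %% M)%N then x else 0)).

(* Main.v *)
Require Import Defs.
From HB Require Import structures.
From mathcomp Require Import all_boot all_order all_algebra.
From mathcomp Require Import all_classical all_reals all_analysis.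
From mathcomp Require Import zify ring lra.
Import Order.TTheory GRing.Theory Num.Theory.
Import numFieldNormedType.Exports.
Set Implicit Arguments. Unset Strict Implicit. Unset Printing Implicit Defensive.
Local Open Scope ring_scope.

(* Write L_j = w_1 ... w_m, where one factor is U_1 and the others are the V_i,
   and let Y_i = w_(i+1) ... w_m X w_1 ... w_i, so that w_i Y_i = Y_(i-1) w_i.
   With F_i = R(Y_i) + h_i, h_i diagonal, the variation w_i F_i - F_(i-1) w_i of
   w_i is confined to the power of lambda carrying the variables v as soon as
   a h_i = h_(i-1) a, where a is the leading coefficient of w_i; the induced
   variation of L_j telescopes to L_j F_m - F_0 L_j.
   For X the gradient of a function and h given by the operator Pi (h constant
   across the V_i, shifted by one across U_1) this is the Hamiltonian vector
   field; for X = 1 and h = 0 it is [L_j, R(L_j)], and the factors then evolve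
   by the lattice equations.
   For the spectral identity, T maps the rows with index j mod m to those with
   index j - 1 mod m through the factors of L_j, so that T^m is block diagonal
   up to a permutation with blocks L_j(lambda^m), which are cyclic
   permutations of one product. *)

(** * Series and two-term factors *)

(* [Factor e a b] stands for the Laurent polynomial a lambda^e + b lambda^(e-1).
   Its left and right actions are defined on all bi-infinite series, so that no
   bound on the powers of lambda has to be tracked. *)
Record factor (R : realType) (n : nat) :=
  Factor { fdeg : int; fhi : 'M[R]_n; flo : 'M[R]_n }.

Section Actions.
Variables (R : realType) (n : nat).
Implicit Types (u v : ser R n) (w : factor R n) (ws : seq (factor R n)).

Definition lmulF w u : ser R n :=
  fun p => fhi w *m u (p - fdeg w) + flo w *m u (p - fdeg w + 1).
Definition rmulF w u : ser R n :=
  fun p => u (p - fdeg w) *m fhi w + u (p - fdeg w + 1) *m flo w.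
Definition lact ws u := foldr lmulF u ws.
Definition ract ws u := foldl (fun x w => rmulF w x) u ws.

Lemma lmulF_rmulF w w' u : lmulF w (rmulF w' u) = rmulF w' (lmulF w u).
Proof.
apply: funext => p; rewrite /lmulF /rmulF !mulmxDr !mulmxDl !mulmxA.
rewrite (_ : p - fdeg w' - fdeg w = p - fdeg w - fdeg w'); last by ring.
rewrite (_ : p - fdeg w + 1 - fdeg w' = p - fdeg w - fdeg w' + 1); last by ring.
rewrite (_ : p - fdeg w' + 1 - fdeg w = p - fdeg w - fdeg w' + 1); last by ring.
by rewrite addrACA.
Qed.

Lemma lact_rmulF ws w u : lact ws (rmulF w u) = rmulF w (lact ws u).
Proof. by elim: ws => //= w' ws ->; rewrite lmulF_rmulF. Qed.

Lemma ract_lmulF ws w u : ract ws (lmulF w u) = lmulF w (ract ws u).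
Proof. by elim: ws u => //= w' ws IH u; rewrite -lmulF_rmulF IH. Qed.

Lemma lact_cat ws ws' u : lact (ws ++ ws') u = lact ws (lact ws' u).
Proof. exact: foldr_cat. Qed.

Lemma ract_cat ws ws' u : ract (ws ++ ws') u = ract ws' (ract ws u).
Proof. exact: foldl_cat. Qed.

Lemma lmulF_one w : lmulF w (oneS R n) = rmulF w (oneS R n).
Proof.
apply: funext => p; rewrite /lmulF /rmulF /oneS.
by do 2!case: ifP => _; rewrite ?mulmx1 ?mul1mx ?mulmx0 ?mul0mx.
Qed.

(** Both sides are the expanded product of the factors, which may thus be built up from either
    end. *)
Lemma lact_one ws : lact ws (oneS R n) = ract ws (oneS R n).
Proof. by elim: ws => //= w ws ->; rewrite -ract_lmulF lmulF_one. Qed.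

Lemma lact_addS ws u v : lact ws (addS u v) = addS (lact ws u) (lact ws v).
Proof.
elim: ws => //= w ws ->; apply: funext => p.
by rewrite /lmulF /addS !mulmxDr addrACA.
Qed.

Lemma ract_addS ws u v : ract ws (addS u v) = addS (ract ws u) (ract ws v).
Proof.
elim: ws u v => //= w ws IH u v; rewrite -IH; congr (ract _ _).
by apply: funext => p; rewrite /rmulF /addS !mulmxDl addrACA.
Qed.

Lemma ract_subS ws u v : ract ws (subS u v) = subS (ract ws u) (ract ws v).
Proof.
elim: ws u v => //= w ws IH u v; rewrite -IH; congr (ract _ _).
by apply: funext => p; rewrite /rmulF /subS !mulmxBl opprD addrACA.
Qed.

(** Cyclicity of the trace, one factor at a time: for the product L of the factors, tr(L u)_0 = tr(u
    L)_0. *)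
Lemma trace_lact_ract ws u : \tr (lact ws u 0) = \tr (ract ws u 0).
Proof.
elim: ws u => //= w ws IH u; rewrite -IH lact_rmulF.
by rewrite /lmulF /rmulF !mxtraceD mxtrace_mulC [X in _ + X]mxtrace_mulC.
Qed.

Definition above (t : int) u := forall p : int, t < p -> u p = 0.
Definition sumdeg ws : int := \sum_(w <- ws) fdeg w.

Lemma above_lmulF t w u : above t u -> above (fdeg w + t) (lmulF w u).
Proof. by move=> hu p hp; rewrite /lmulF !hu ?mulmx0 ?addr0 //; lia. Qed.

Lemma above_rmulF t w u : above t u -> above (fdeg w + t) (rmulF w u).
Proof. by move=> hu p hp; rewrite /rmulF !hu ?mul0mx ?addr0 //; lia. Qed.

Lemma above_lact t ws u : above t u -> above (sumdeg ws + t) (lact ws u).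
Proof.
move=> hu; rewrite /sumdeg; elim: ws => [|w ws IH]; first by rewrite big_nil add0r.
by rewrite big_cons -addrA; exact: above_lmulF.
Qed.

Lemma above_ract t ws u : above t u -> above (sumdeg ws + t) (ract ws u).
Proof.
rewrite /sumdeg; elim: ws u t => [|w ws IH] u t hu; first by rewrite big_nil add0r.
by rewrite big_cons -addrA addrCA; apply/IH/above_rmulF.
Qed.

Lemma above_one : above 0 (oneS R n).
Proof. by move=> p hp; rewrite /oneS; case: eqP => // hp0; lia. Qed.

(** The added terms involve coefficients of v above [tv] and vanish. Sums of different lengths can
    thus be brought to a common length. *)
Lemma mulS_wide (tu tv : int) u v (p : int) (K : nat) : above tv v -> tu + tv - p < K%:Z ->
  mulS tu tv u v p = \sum_(k < K) (u (tu - k%:Z) *m v (p - tu + k%:Z)).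
Proof.
move=> hv hK; rewrite /mulS; case: ifP => hp.
  set K0 := (absz _).+1; have hK0 : (K0 <= K)%N by rewrite /K0; lia.
  rewrite -!(big_mkord xpredT (fun k : nat => u (tu - k%:Z) *m v (p - tu + k%:Z))).
  rewrite [RHS](big_cat_nat (n := K0)) //= -[LHS]addr0; congr (_ + _).
  rewrite big_nat big1 // => k /andP[hk _]; rewrite hv ?mulmx0 //.
  by move: hk; rewrite /K0; lia.
by rewrite big1 // => k _; rewrite hv ?mulmx0 //; lia.
Qed.

Arguments mulS_wide {tu tv u v p} K _ _.

Lemma mulS_1l (t : int) u : above t u -> mulS 0 t (oneS R n) u = u.
Proof.
move=> hu; apply: funext => p.
rewrite (mulS_wide (absz (t - p)%R).+1) //; last by lia.
rewrite big_ord_recl /= big1 ?addr0; last first.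
  by move=> k _; rewrite /oneS; case: eqP => [h|_]; rewrite ?mul0mx //; lia.
by rewrite [oneS _ _ _]/= mul1mx; congr (u _); lia.
Qed.

Lemma mulS_1r (t : int) u : above t u -> mulS t 0 u (oneS R n) = u.
Proof.
move=> hu; apply: funext => p; rewrite /mulS addr0; case: ifP => hp; last first.
  by rewrite hu //; lia.
rewrite big_ord_recr /= big1 ?add0r; last first.
  move=> k _; rewrite /oneS; case: eqP => [h|_]; rewrite ?mulmx0 //.
  by have := ltn_ord k; lia.
rewrite /oneS (_ : p - t + _ = 0) ?eqxx ?mulmx1; last by lia.
by congr (u _); lia.
Qed.

Lemma mulS_lmulF (tu tv : int) w u v : above tu u -> above tv v ->
  mulS (fdeg w + tu) tv (lmulF w u) v = lmulF w (mulS tu tv u v).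
Proof.
move=> hu hv; apply: funext => p; rewrite [in RHS]/lmulF.
pose K := (absz (fdeg w + tu + tv - p)%R).+1.
rewrite (mulS_wide K.+1) //; last by rewrite /K; lia.
rewrite [mulS tu tv u v (p - fdeg w)](mulS_wide K.+1) //; last by rewrite /K; lia.
rewrite (mulS_wide K) //; last by rewrite /K; lia.
rewrite !mulmx_sumr /lmulF.
under eq_bigr do rewrite mulmxDl.
rewrite big_split /=; congr (_ + _).
  apply: eq_bigr => k _; rewrite -mulmxA.
  by congr (_ *m (u _ *m v _)); ring.
rewrite big_ord_recl /= hu ?mulmx0 ?mul0mx ?add0r; last by lia.
apply: eq_bigr => k _; rewrite -mulmxA.
by congr (_ *m (u _ *m v _)); rewrite /bump /=; lia.
Qed.

Lemma mulS_rmulF (tu tv : int) w u v : above tu u -> above tv v ->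
  mulS tu (fdeg w + tv) u (rmulF w v) = rmulF w (mulS tu tv u v).
Proof.
move=> hu hv; apply: funext => p; rewrite [in RHS]/rmulF.
pose K := (absz (fdeg w + tu + tv - p)%R).+1.
rewrite (mulS_wide K); [|exact: above_rmulF|by rewrite /K; lia].
rewrite [mulS tu tv u v (p - fdeg w)](mulS_wide K) //; last by rewrite /K; lia.
rewrite (mulS_wide K) //; last by rewrite /K; lia.
rewrite !mulmx_suml -big_split /=; apply: eq_bigr => k _.
rewrite /rmulF mulmxDr !mulmxA.
by congr (_ *m v _ *m _ + _ *m v _ *m _); ring.
Qed.

(** Trades the bounded product with the expanded product of [ws] for the action of [ws], in which no
    bounds occur. *)
Lemma mulS_lact t ws u : above t u ->
  mulS (sumdeg ws) t (lact ws (oneS R n)) u = lact ws u.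
Proof.
move=> hu; rewrite /sumdeg; elim: ws => [|w ws IH]; first by rewrite big_nil mulS_1l.
rewrite big_cons /= mulS_lmulF ?IH //.
by have := above_lact (ws := ws) above_one; rewrite addr0.
Qed.

Lemma mulS_ract t ws u : above t u ->
  mulS t (sumdeg ws) u (ract ws (oneS R n)) = ract ws u.
Proof.
move=> hu; elim/last_ind: ws => [|ws w IH]; first by rewrite /sumdeg big_nil mulS_1r.
rewrite /sumdeg -cats1 big_cat big_seq1 /= addrC !ract_cat /= mulS_rmulF ?IH //.
by have := above_ract (ws := ws) above_one; rewrite addr0.
Qed.

End Actions.

(** * Telescoping products *)

Section MatrixDerive.
Variables (R : realType) (T : normedModType R) (x v : T).

Lemma is_derive_mxP m n (M : T -> 'M[R]_(m, n)) (dM : 'M[R]_(m, n)) :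
  is_derive x v M dM <-> forall i j, is_derive x v (fun y => M y i j) (dM i j).
Proof.
split=> [[Mv <-] i j | Mij].
  rewrite derive_mx // mxE; apply/derivableP; by move/derivable_mxP: Mv; exact.
have Mv : derivable M x v by apply/derivable_mxP => i j; case: (Mij i j).
by split=> //; rewrite derive_mx //; apply/matrixP => i j; rewrite mxE; case: (Mij i j).
Qed.

Lemma is_derive_mulmx m n p (A : T -> 'M[R]_(m, n)) (B : T -> 'M[R]_(n, p)) dA dB :
  is_derive x v A dA -> is_derive x v B dB ->
  is_derive x v (fun y => A y *m B y) (dA *m B x + A x *m dB).
Proof.
move=> /is_derive_mxP hA /is_derive_mxP hB; apply/is_derive_mxP => i j.
have := @is_derive_sum R T R n (fun k y => A y i k * B y k j) x v
  (fun k => A x i k *: dB k j + B x k j *: dA i k)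
  (fun k => is_deriveM (hA i k) (hB k j)).
rewrite (_ : \sum_k _ = (fun y => (A y *m B y) i j)); last first.
  by apply: funext => y; rewrite fct_sumE mxE.
move=> /is_derive_eq; apply; rewrite !mxE -big_split; apply: eq_bigr => k _ /=.
by rewrite /GRing.scale /= addrC; congr (_ + _); rewrite mulrC.
Qed.

(** The difference quotient of a linear map is constantly [f w] away from h = 0. *)
Lemma is_derive_linear_dir n m p q (f : {linear 'M[R]_(m, n) -> 'M[R]_(p, q)})
    (x0 w : 'M[R]_(m, n)) : is_derive x0 w f (f w).
Proof.
have E : ((fun h : R => h^-1 *: ((f \o shift x0) (h *: w) - f x0)) @ (0 : R)^' --> f w)%classic.
  apply: cvg_near_cst; near=> h.
  have h0 : h != 0 by near: h; exact: nbhs_dnbhs_neq.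
  by rewrite /= [f (_ + _)]linearD addrK [f (_ *: _)]linearZ scalerA mulVf ?scale1r.
split; first by apply/cvg_ex; exists (f w).
exact: cvg_lim E.
Unshelve. all: by end_near. Qed.

End MatrixDerive.

Section Telescope.
Variables (R : realType) (n : nat).
Implicit Types (u : ser R n) (w : factor R n) (ws : seq (factor R n)).

Lemma ract_shift ws (d : 'M[R]_n) (c : int) u :
  ract ws (fun p => d *m u (p - c)) = fun p => d *m ract ws u (p - c).
Proof.
elim: ws u => //= w ws IH u; rewrite -IH; congr (ract _ _).
apply: funext => p; rewrite /rmulF mulmxDr !mulmxA.
by congr (_ *m u _ *m _ + _ *m u _ *m _); ring.
Qed.

(** In this form the variation of one factor, a monomial in lambda, passes through the factors to
    its right. *)
Lemma ract_mono ws (d : 'M[R]_n) (c p : int) :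
  ract ws (fun p => if p == c then d else 0) p = d *m ract ws (oneS R n) (p - c).
Proof.
rewrite -[RHS](congr1 (@^~ p) (ract_shift ws d c (oneS R n))); congr (ract _ _ _).
by apply: funext => q; rewrite /oneS subr_eq0; case: eqP; rewrite ?mulmx1 ?mulmx0.
Qed.

Section DeriveProduct.
Variables (T : normedModType R) (x v : T) (I : eqType).
Variables (e : I -> int) (a : I -> 'M[R]_n) (b : I -> T -> 'M[R]_n) (db : I -> 'M[R]_n).
Variables (s : seq I) (F : seq I -> seq I -> ser R n).
Let fs y := map (fun i => Factor (e i) (a i) (b i y)).

(* If each factor w_i of a product satisfies dw_i = w_i F_i - F_(i-1) w_i, the
   sum given by the product rule telescopes; F_i is indexed by the lists of
   factors to its left and to its right. *)
Lemma is_derive_lact :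
  {in s, forall i, is_derive x v (b i) (db i)} ->
  (forall pre i post p, s = pre ++ i :: post ->
     subS (lmulF (Factor (e i) (a i) (b i x)) (F (rcons pre i) post))
          (rmulF (Factor (e i) (a i) (b i x)) (F pre (i :: post))) p =
     if p == e i - 1 then db i else 0) ->
  forall p, is_derive x v (fun y => lact (fs y s) (oneS R n) p)
    (lact (fs x s) (F s [::]) p - ract (fs x s) (F [::] s) p).
Proof.
move=> hb hF.
(* Generalised to every suffix [post]: its product varies by a boundary term at the end of the list
   minus one at the cut after [pre]. *)
suff H post : forall pre, s = pre ++ post -> forall p,
    is_derive x v (fun y => lact (fs y post) (oneS R n) p)
    (lact (fs x post) (F s [::]) p - ract (fs x post) (F pre post) p) by exact: H.
elim: post => [|i post IH] pre es p.
  by rewrite es cats0 /= subrr; exact: is_derive_cst.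
have hi : is_derive x v (b i) (db i) by apply: hb; rewrite es mem_cat mem_head orbT.
have {}IH := IH (rcons pre i); rewrite cat_rcons in IH; have {}IH := IH es.
rewrite /= /lmulF /=; apply: is_derive_eq.
  apply: is_deriveD; last exact: is_derive_mulmx.
  exact: is_derive_mulmx (is_derive_cst (a i) x v) (IH _).
rewrite mul0mx add0r /= -/(fs x).
set w := Factor _ _ _ in hF *.
(* The hypothesis on dw_i, solved for F_(i-1) w_i. It moves the boundary term across w_i and
   produces exactly the term dw_i of the product rule. *)
have E : rmulF w (F pre (i :: post)) = subS (lmulF w (F (rcons pre i) post))
    (fun p => if p == e i - 1 then db i else 0).
  by apply: funext => q; rewrite /subS -(hF _ _ _ _ es) /subS opprB addrC subrK.
rewrite E ract_subS ract_lmulF /subS ract_mono -lact_one /lmulF /=.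
rewrite !mulmxBr (_ : p - (e i - 1) = p - e i + 1); last by ring.
rewrite !opprD !opprK !addrA.
move: (_ *m _) (_ *m _) (_ *m _) (_ *m _) (_ *m _) => A1 A2 B1 B2 B3.
by apply/matrixP => k l; rewrite !mxE; ring.
Qed.

End DeriveProduct.

Definition Rshift u (h : 'M[R]_n) : ser R n :=
  fun p => Rop u p + (if p == 0 then h else 0).

Lemma RopE u p : Rop u p = if 0 <= p then 2^-1 *: u p else - (2^-1 *: u p).
Proof.
rewrite /Rop /halfS /addS /R0op /subS /Pplus /Pminus /Pzero.
by case: ltrgt0P => hp; rewrite ?subr0 ?addr0 ?sub0r ?add0r ?scalerN.
Qed.

(* Adding or removing u/2 turns Rshift into a series with only nonnegative,
   respectively only nonpositive, powers of lambda: this confines the result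
   to a single power. *)
Lemma telescope_term w u u' (h h' : 'M[R]_n) p :
  lmulF w u = rmulF w u' -> fhi w *m h = h' *m fhi w ->
  subS (lmulF w (Rshift u h)) (rmulF w (Rshift u' h')) p =
  if p == fdeg w - 1 then flo w *m (u 0 + h) - (u' 0 + h') *m flo w else 0.
Proof.
move=> /(congr1 (@^~ p)) E hh.
rewrite (_ : (p == fdeg w - 1) = (p - fdeg w == -1)); last by apply/eqP/eqP; lia.
move: E; rewrite /subS /lmulF /rmulF /Rshift !RopE.
move: (p - fdeg w) => q E.
(* For q >= 0 both coefficients of u carry 1/2 and the h-terms cancel; for q < -1 both carry -1/2.
   In these cases E gives zero. Only at q = -1 are the signs mixed. *)
case: (leP 0 q) => hq0.
  have [-> -> ->] : [/\ (0 <= q + 1) = true, (q + 1 == 0) = false & (q == -1) = false].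
    by split; apply/idP/idP; lia.
  have -> : fhi w *m (2^-1 *: u q + (if q == 0 then h else 0)) =
     2^-1 *: (fhi w *m u q) + (if q == 0 then fhi w *m h else 0).
    by rewrite mulmxDr -scalemxAr; case: eqP; rewrite ?mulmx0.
  have -> : (2^-1 *: u' q + (if q == 0 then h' else 0)) *m fhi w =
     2^-1 *: (u' q *m fhi w) + (if q == 0 then fhi w *m h else 0).
    by rewrite mulmxDl -scalemxAl hh; case: eqP; rewrite ?mul0mx.
  rewrite !addr0 -scalemxAr -scalemxAl; move: E.
  move: (_ *m u q) (_ *m u (q + 1)) (u' q *m _) (u' (q + 1) *m _) => A B A' B' E.
  rewrite -(addrAC _ (2^-1 *: B)) -(addrAC _ (2^-1 *: B')) -!scalerDr E.
  exact: subrr.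
have -> : (q == 0) = false by lia.
case: (q =P -1) => hq.
  rewrite hq (_ : (-1 : int) + 1 = 0) // eqxx lexx !addr0 in E *.
  rewrite !mulmxDr !mulmxDl mulmxN mulNmx -!scalemxAr -!scalemxAl.
  move: E.
  move: (fhi w *m u (-1)) (flo w *m u 0) (u' (-1) *m _) (u' 0 *m _) (_ *m h) (h' *m _).
  move=> A B A' B' H H' /matrixP E.
  by apply/matrixP => i j; move: (E i j); rewrite !mxE; lra.
have [-> ->] : (0 <= q + 1) = false /\ (q + 1 == 0) = false.
  by split; apply/idP/idP; lia.
rewrite !addr0 !mulmxN !mulNmx -!scalemxAr -!scalemxAl -!opprD -!scalerDr E.
by rewrite subrr oppr0.
Qed.

End Telescope.

(** * The grading and the factors of L_j *)

Section Graded.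
Variables (R : realType) (n : nat).
Implicit Types (A B : 'M[R]_n) (d : int).

Definition graded d A :=
  forall i l : 'I_n, ~~ (n%:Z %| (i%:Z - l%:Z - d))%Z -> A i l = 0.

Lemma graded0 d : graded d 0.
Proof. by move=> i l _; rewrite mxE. Qed.

Lemma gradedD d A B : graded d A -> graded d B -> graded d (A + B).
Proof. by move=> hA hB i l h; rewrite mxE hA ?hB ?addr0. Qed.

Lemma gradedB d A B : graded d A -> graded d B -> graded d (A - B).
Proof. by move=> hA hB i l h; rewrite !mxE hA ?hB ?subr0. Qed.

Lemma gradedZ d c A : graded d A -> graded d (c *: A).
Proof. by move=> hA i l h; rewrite mxE hA ?mulr0. Qed.

Lemma gradedM d d' A B : graded d A -> graded d' B -> graded (d + d') (A *m B).
Proof.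
move=> hA hB i l h; rewrite mxE big1 // => k _.
have [hk|/hA->] := boolP (n%:Z %| (i%:Z - k%:Z - d))%Z; last by rewrite mul0r.
rewrite hB ?mulr0 //; apply: contra h => hk'.
have -> : i%:Z - l%:Z - (d + d') = (i%:Z - k%:Z - d) + (k%:Z - l%:Z - d') by ring.
exact: rpredD.
Qed.

Lemma graded_diag A (i l : 'I_n) : graded 0 A -> i != l -> A i l = 0.
Proof.
move=> hA hil; apply: hA; rewrite subr0; apply: contra hil => /dvdzP[q hq].
apply/eqP/val_inj => /=; have hi := ltn_ord i; have hl := ltn_ord l.
by case: (ltrgtP q 0) => [q0|q0|q0]; nia.
Qed.

Lemma graded_superdiag A (k l : 'I_n) : graded (-1) A -> l != ordS k -> A k l = 0.
Proof.
move=> hA hkl; apply: hA; apply: contra hkl => /dvdzP[q hq].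
apply/eqP/val_inj => /=; have hk := ltn_ord k; have hl := ltn_ord l.
have [hk1|hk1] := ltnP k.+1 n; first rewrite modn_small //.
  by case: (ltrgtP q 0) => [q0|q0|q0]; nia.
have -> : k.+1 = n by lia.
by rewrite modnn; case: (ltrgtP q 1) => [q0|q0|q0]; nia.
Qed.

Definition gradedS (u : ser R n) := forall p, graded p (u p).
Definition gradedF (w : factor R n) := graded (fdeg w) (fhi w) /\ graded (fdeg w - 1) (flo w).

Lemma gradedS_lmulF w u : gradedF w -> gradedS u -> gradedS (lmulF w u).
Proof.
move=> [ha hb] hu p; apply: gradedD.
  by rewrite -{1}[p](subrKC (fdeg w)); apply: gradedM.
have {1}-> : p = fdeg w - 1 + (p - fdeg w + 1) by ring.
exact: gradedM.
Qed.

Lemma gradedS_rmulF w u : gradedF w -> gradedS u -> gradedS (rmulF w u).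
Proof.
move=> [ha hb] hu p; apply: gradedD.
  by rewrite -{1}[p](subrK (fdeg w)); apply: gradedM.
have {1}-> : p = (p - fdeg w + 1) + (fdeg w - 1) by ring.
exact: gradedM.
Qed.

Lemma gradedS_lact ws u : (forall w, List.In w ws -> gradedF w) ->
  gradedS u -> gradedS (lact ws u).
Proof.
move=> hws hu; elim: ws hws => //= w ws IH hws.
by apply: gradedS_lmulF; [apply: hws; left | apply: IH => w' ?; apply: hws; right].
Qed.

Lemma gradedS_ract ws u : (forall w, List.In w ws -> gradedF w) ->
  gradedS u -> gradedS (ract ws u).
Proof.
move=> hws hu; elim: ws u hu hws => //= w ws IH u hu hws.
apply: IH => [|w' ?]; last by apply: hws; right.
by apply: gradedS_rmulF => //; apply: hws; left.
Qed.

End Graded.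

(** * The factors U_1 and V_i *)

Section Factors.
Variables (R : realType) (m N : nat).
Implicit Types V : 'M[R]_(m, N).

Definition shiftmx : 'M[R]_N :=
  \matrix_(k, l) (if (k : nat) == ((l : nat).+1 %% N)%N then 1 else 0).

Definition lowmx (i : nat) V : 'M[R]_N :=
  if i == 1%N then \matrix_(k, l) (if k == l then vrow V 1 k else 0)
  else \matrix_(k, l) (if (l : nat) == ((k : nat).+1 %% N)%N then vrow V i k else 0).

Definition facdeg (i : nat) : int := if i == 1%N then 1 else 0.
Definition fachi (i : nat) : 'M[R]_N := if i == 1%N then shiftmx else 1%:M.

(* The factor with index 1 is U_1, the others are the V_i. *)
Definition fac V (i : nat) := Factor (facdeg i) (fachi i) (lowmx i V).

(** Indices of the factors of L_j from left to right: j, ..., 2, 1, m, ..., j+1. *)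
Definition Lids (j : nat) := rev (iota 2 j.-1) ++ 1%N :: rev (iota j.+1 (m - j)).

Lemma VserE V i : i != 1%N -> Vser V i = lmulF (fac V i) (oneS R N).
Proof.
move=> /negPf hi; apply: funext => p.
rewrite /Vser /lmulF /fac /facdeg /fachi /lowmx hi /= subr0 /oneS.
case: eqP => [->|hp]; first by rewrite mulmx1 mulmx0 addr0.
have -> : (p + 1 == 0) = (p == -1) by lia.
by rewrite mulmx0 add0r; case: eqP; rewrite ?mulmx1 ?mulmx0.
Qed.

Lemma U1serE V : U1ser V = lmulF (fac V 1) (oneS R N).
Proof.
apply: funext => p; rewrite /U1ser /lmulF /fac /facdeg /fachi /lowmx /= subrK /oneS.
rewrite subr_eq0; case: eqP => [->|hp]; first by rewrite mulmx1 mulmx0 addr0.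
by rewrite mulmx0 add0r; case: eqP; rewrite ?mulmx1 ?mulmx0.
Qed.

Lemma above_facs V s : 1%N \notin s -> above 0 (lact (map (fac V) s) (oneS R N)).
Proof.
move=> hs; have := above_lact (ws := map (fac V) s) (above_one R N).
rewrite addr0 /sumdeg big_map big1_seq // => i /andP[_ hi].
by rewrite /= /facdeg; case: eqP => // h; rewrite -h hi in hs.
Qed.

Lemma prodVE V s : 1%N \notin s -> prodV V s = lact (map (fac V) s) (oneS R N).
Proof.
elim: s => //= i s IH; rewrite inE negb_or eq_sym => /andP[hi hs].
rewrite IH // VserE //.
have := mulS_lmulF (fac V i) (above_one R N) (above_facs V hs).
by rewrite {1}/fdeg /= {1}/facdeg (negPf hi) addr0 (mulS_1l (above_facs V hs)).
Qed.

Lemma sumdeg_facs V s : sumdeg (map (fac V) s) = (count_mem 1%N s)%:Z.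
Proof.
rewrite /sumdeg big_map; elim: s => [|i s IH]; first by rewrite big_nil.
by rewrite big_cons IH /= /facdeg; case: eqP.
Qed.

(** Only U_1 has degree 1, so the bounds written in [Lser] are the degrees of the partial products
    and every [mulS] becomes an action. *)
Lemma LserE j V : (0 < j)%N -> Lser j V = lact (map (fac V) (Lids j)) (oneS R N).
Proof.
move=> hj; have h1 : 1%N \notin rev (iota 2 j.-1) by rewrite mem_rev mem_iota.
have h2 : 1%N \notin rev (iota j.+1 (m - j)) by rewrite mem_rev mem_iota; lia.
rewrite /Lser !prodVE // U1serE /Lids map_cat /= -cat_rcons -cats1 !lact_cat /=.
have hs s : 1%N \notin s -> sumdeg (map (fac V) s) = 0.
  by rewrite sumdeg_facs => /count_memPn ->.
have hU : above 1 (lmulF (fac V 1) (oneS R N)).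
  by have := above_lmulF (w := fac V 1) (above_one R N); rewrite addr0.
have := mulS_lact (map (fac V) (rev (iota 2 j.-1))) hU.
rewrite (hs _ h1) => ->.
have -> : lact (map (fac V) (rev (iota 2 j.-1))) (lmulF (fac V 1) (oneS R N)) =
  lact (map (fac V) (rev (iota 2 j.-1) ++ [:: 1%N])) (oneS R N).
  by rewrite map_cat lact_cat.
have := mulS_lact (map (fac V) (rev (iota 2 j.-1) ++ [:: 1%N])) (above_facs V h2).
rewrite sumdeg_facs count_cat (count_memPn h1) /= => ->.
by rewrite map_cat lact_cat.
Qed.

Lemma mem_Lids j i : (0 < j <= m)%N -> (i \in Lids j) = (0 < i <= m)%N.
Proof. by move=> hj; rewrite mem_cat inE !mem_rev !mem_iota; lia. Qed.

Lemma uniq_Lids j : (0 < j)%N -> uniq (Lids j).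
Proof.
move=> hj; rewrite cat_uniq cons_uniq !rev_uniq !iota_uniq mem_rev mem_iota andbT andTb.
apply/andP; split; last by lia.
by apply/hasPn => i; rewrite inE !mem_rev !mem_iota; lia.
Qed.

Lemma sumdeg_Lids V j : (0 < j <= m)%N -> sumdeg (map (fac V) (Lids j)) = 1.
Proof.
move=> hj; rewrite sumdeg_facs count_uniq_mem ?uniq_Lids ?mem_Lids; lia.
Qed.

Lemma graded_one : graded 0 (1%:M : 'M[R]_N).
Proof.
move=> i l h; rewrite mxE; case: eqP => // e; move: h.
by rewrite e subrr subr0 dvdz0.
Qed.

Lemma modn_dvdz (k : nat) : (N%:Z %| ((k %% N)%N%:Z - k%:Z))%Z.
Proof.
apply/dvdzP; exists (- (k %/ N)%N%:Z); have := divn_eq k N; nia.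
Qed.

(** E_(k+1,k) has degree 1 and E_(k,k+1) degree -1, also at the wrap-around, since degrees are read
    mod N. *)
Lemma gradedF_fac V i : gradedF (fac V i).
Proof.
rewrite /gradedF /fac /= /facdeg /fachi /lowmx; case: (i == 1%N) => /=; split.
- move=> k l; rewrite mxE; case: eqP => // -> /negP[].
  have -> : (l.+1 %% N)%N%:Z - l%:Z - 1 = (l.+1 %% N)%N%:Z - l.+1%:Z by lia.
  exact: modn_dvdz.
- move=> k l; rewrite mxE; case: eqP => // -> /negP[].
  by rewrite !subrr dvdz0.
- exact: graded_one.
move=> k l; rewrite mxE; case: eqP => // -> /negP[].
have -> : (k%:Z - (k.+1 %% N)%N%:Z - (0 - 1)) = - ((k.+1 %% N)%N%:Z - k.+1%:Z) by lia.
by rewrite rpredN; exact: modn_dvdz.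
Qed.

Lemma vrowE V (i : 'I_m) k : vrow V i.+1 k = V i k.
Proof. by rewrite /vrow /= valK. Qed.

Lemma vrow_linear i k c V V' :
  vrow (c *: V + V') i k = c * vrow V i k + vrow V' i k.
Proof. by rewrite /vrow; case: insub => [j|]; rewrite ?mxE ?mulr0 ?addr0. Qed.

Lemma lowmx_is_linear i : linear (lowmx i).
Proof.
move=> c V V'; rewrite /lowmx; case: (i == 1%N); apply/matrixP => k l;
  by rewrite !mxE; case: ifP => _; rewrite ?vrow_linear ?mulr0 ?addr0.
Qed.

HB.instance Definition _ i := GRing.isLinear.Build R 'M[R]_(m, N) 'M[R]_N _ (lowmx i)
  (lowmx_is_linear i).

Lemma is_derive_lowmx i V W : is_derive V W (lowmx i) (lowmx i W).
Proof. exact: (is_derive_linear_dir (lowmx i)). Qed.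

(** A matrix of degree 0 is diagonal and one of degree -1 is cyclically superdiagonal, which is all
    that v can produce. This supplies the tangent vector W. *)
Lemma lowmx_surj (D : nat -> 'M[R]_N) :
  (forall i, (0 < i <= m)%N -> graded (facdeg i - 1) (D i)) ->
  exists W, forall i, (0 < i <= m)%N -> lowmx i W = D i.
Proof.
(* Row i of the witness belongs to the factor i+1; it reads the entries (k,k) for U_1 and (k,k+1)
   for the V_i. *)
move=> hD; exists (\matrix_(i, k) D i.+1 k (if i.+1 == 1%N then k else ordS k)).
move=> i hi; have hi' : (i.-1 < m)%N by lia.
have ei : i = (Ordinal hi').+1 by rewrite /=; lia.
have := hD i hi; rewrite /lowmx /facdeg; case: eqP => [->|hi1] gD; apply/matrixP => k l.
  have hm : (0 < m)%N by lia.
  rewrite mxE -[1%N]/((Ordinal hm).+1) vrowE mxE /=.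
  by case: eqP => [->//|/eqP hkl]; rewrite graded_diag //; move: gD; rewrite subrr.
rewrite mxE {1}ei vrowE mxE -ei.
have -> : ((l : nat) == (k.+1 %% N)%N) = (l == ordS k) by [].
rewrite (negPf (introN eqP hi1)).
by case: eqP => [->//|/eqP hkl]; rewrite graded_superdiag //; move: gD; rewrite sub0r.
Qed.

End Factors.

(** * Hamiltonian vector fields *)

Section Dressing.
Variables (R : realType) (m N : nat) (V : 'M[R]_(m, N)) (X : ser R N) (h0 h1 : 'M[R]_N).
Let ws := map (fac V).

(** [dressed] is Y_i, with w_1 ... w_i in [pre] and the other factors in [post]. [dressing] is h_i:
    it equals h0 to the left of U_1 and h1 to its right. *)
Definition dressed (pre post : seq nat) := lact (ws post) (ract (ws pre) X).
Definition dressing (post : seq nat) := if 1%N \in post then h0 else h1.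
Definition dressed_diff pre i post :=
  lowmx i V *m (dressed (rcons pre i) post 0 + dressing post)
  - (dressed pre (i :: post) 0 + dressing (i :: post)) *m lowmx i V.

Lemma dressed_intertwine pre i post :
  lmulF (fac V i) (dressed (rcons pre i) post) = rmulF (fac V i) (dressed pre (i :: post)).
Proof.
by rewrite /dressed /ws map_rcons -cats1 ract_cat /= lact_rmulF lmulF_rmulF.
Qed.

(** Common core of the Hamiltonian and the Lax computation: if every factor varies by
    [dressed_diff], then L_j varies by L_j F_m - F_0 L_j. *)
Lemma is_derive_Lser (T : normedModType R) (x v : T) (Vt : T -> 'M[R]_(m, N))
    (dlow : nat -> 'M[R]_N) (j : nat) :
  (0 < j <= m)%N -> Vt x = V -> shiftmx R N *m h1 = h0 *m shiftmx R N ->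
  (forall i, (0 < i <= m)%N -> is_derive x v (fun y => lowmx i (Vt y)) (dlow i)) ->
  (forall pre i post, Lids m j = pre ++ i :: post -> dlow i = dressed_diff pre i post) ->
  forall p, is_derive x v (fun y => Lser j (Vt y) p)
    (lact (ws (Lids m j)) (Rshift (ract (ws (Lids m j)) X) h1) p
     - ract (ws (Lids m j)) (Rshift (lact (ws (Lids m j)) X) h0) p).
Proof.
move=> hj Vx hh hlow hdiff p.
have hj0 : (0 < j)%N by case/andP: hj.
rewrite (_ : (fun y => _) = fun y => lact (map (fac (Vt y)) (Lids m j)) (oneS R N) p);
  last by apply: funext => y; rewrite LserE.
have := is_derive_lact (x := x) (v := v) (e := facdeg) (a := @fachi R N)
  (b := fun i y => lowmx i (Vt y)) (db := dlow) (s := Lids m j)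
  (F := fun pre post => Rshift (dressed pre post) (dressing post)).
rewrite Vx /dressed /dressing /= mem_Lids // (_ : (0 < 1 <= m)%N = true); last by lia.
apply.
  by move=> i hi; apply: hlow; rewrite -(mem_Lids i hj).
move=> pre i post q es; rewrite -/(fac V i).
have -> : dlow i = dressed_diff pre i post by exact: hdiff.
apply: telescope_term; first exact: dressed_intertwine.
(* The condition a h_i = h_(i-1) a: trivial for V_i, where a = 1 and h does not change; for U_1 it
   is the assumption on h0 and h1, as the index 1 does not recur in [post]. *)
rewrite /= /fachi inE [(1 == i)%N]eq_sym.
case: eqP => [ei|_] /=; last by rewrite mul1mx mulmx1.
suff /negPf -> : 1%N \notin post by [].
have := uniq_Lids m hj0; rewrite es ei cat_uniq /=.
by case/andP=> _ /andP[_ /andP[]].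
Qed.

Hypothesis X_graded : gradedS X.
Hypothesis h0_graded : graded 0 h0.
Hypothesis h1_graded : graded 0 h1.

Lemma gradedS_dressed pre post : gradedS (dressed pre post).
Proof.
have hw s w : List.In w (ws s) -> gradedF w.
  by elim: s => //= i s IH [<-|/IH //]; exact: gradedF_fac.
by apply: gradedS_lact; [exact: hw | apply: gradedS_ract => //; exact: hw].
Qed.

Lemma graded_dressed_diff pre i post : graded (facdeg i - 1) (dressed_diff pre i post).
Proof.
have hlow := (gradedF_fac V i).2.
have hs s : graded 0 (dressing s) by rewrite /dressing; case: ifP.
apply: gradedB.
  rewrite -[_ - _]addr0; apply: gradedM => //; apply: gradedD => //.
  exact: gradedS_dressed.
rewrite -[_ - _]add0r; apply: gradedM => //; apply: gradedD => //.
exact: gradedS_dressed.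
Qed.

End Dressing.

(** * The diagonal parts of the operators A, B, C, D *)

Section DiagonalSplit.
Variables (R : realType) (n : nat) (u0 u1 : ser R n).

(** With u0 = L X and u1 = X L, these are the degree-0 corrections that turn R(u1) into A(u1) +
    B(u0) and R(u0) into D(u0) + C(u1). *)
Definition hdiag1 : 'M[R]_n := 2^-1 *: (PiOp u1 0 + (u0 0 - PiOp u0 0)) - 2^-1 *: u1 0.
Definition hdiag0 : 'M[R]_n := 2^-1 *: (- PiOp u0 0 + (u1 0 + PiOp u1 0)) - 2^-1 *: u0 0.

Lemma Aop_Bop : addS (Aop u1) (Bop u0) = Rshift u1 hdiag1.
Proof.
apply: funext => p; rewrite /Rshift /hdiag1 /addS /Aop /Bop /Rop /halfS /addS /R0op /subS.
rewrite /Pplus /Pminus /Pzero /PiOp eqxx.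
case: (ltrgtP p 0) => [hp|hp|->]; try by rewrite !subr0 !addr0 scaler0 addr0.
by rewrite subrr !add0r -scalerDr [RHS]addrC subrK.
Qed.

Lemma Dop_Cop : addS (Dop u0) (Cop u1) = Rshift u0 hdiag0.
Proof.
apply: funext => p; rewrite /Rshift /hdiag0 /addS /Dop /Cop /Rop /halfS /addS /R0op /subS.
rewrite /Pplus /Pminus /Pzero /PiOp eqxx.
case: (ltrgtP p 0) => [hp|hp|->]; try by rewrite !subr0 !addr0 scaler0 addr0.
by rewrite subrr !add0r -scalerDr [RHS]addrC subrK.
Qed.

Lemma graded_PiOp (u : ser R n) : graded 0 (PiOp u 0).
Proof.
move=> i l; rewrite /PiOp eqxx mxE; case: eqP => // ->.
by rewrite !subrr dvdz0.
Qed.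

Hypothesis g0 : graded 0 (u0 0).
Hypothesis g1 : graded 0 (u1 0).

Lemma graded_hdiag0 : graded 0 hdiag0.
Proof.
have gP := graded_PiOp.
apply: gradedB; last exact: gradedZ.
apply: gradedZ; rewrite addrC; apply: gradedB => //; exact: gradedD.
Qed.

Lemma graded_hdiag1 : graded 0 hdiag1.
Proof.
have gP := graded_PiOp; apply: gradedB; last exact: gradedZ.
by apply: gradedZ; apply: gradedD => //; exact: gradedB.
Qed.

Let d j := u1 0 j j - u0 0 j j.

(** The diagonal contribution -d_l replaces the coefficient pi_ll = 0 by -1; in [hdiag0E] the
    contribution +d_l replaces it by 1. *)
Lemma hdiag1E l : hdiag1 l l = 2^-1 * \sum_j d j * (if (l < j)%N then 1 else -1).
Proof.
rewrite /hdiag1 /PiOp eqxx !mxE eqxx.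
have -> : \sum_j d j * (if (l < j)%N then 1 else -1) =
  \sum_j u1 0 j j * piC R j l - \sum_j u0 0 j j * piC R j l - d l.
  rewrite -sumrB [LHS](bigD1 l) // [in RHS](bigD1 l) //= ltnn /piC ltnn.
  rewrite addrAC mulr0 mulr0 subrr add0r mulrN1; congr (_ + _).
  apply: eq_bigr => j hj; rewrite -mulrBl; congr (_ * _).
  by case: ltngtP hj => // /val_inj ->; rewrite eqxx.
by rewrite /d; ring.
Qed.

Lemma hdiag0E l : hdiag0 l l = 2^-1 * \sum_j d j * (if (l <= j)%N then 1 else -1).
Proof.
rewrite /hdiag0 /PiOp eqxx !mxE eqxx.
have -> : \sum_j d j * (if (l <= j)%N then 1 else -1) =
  \sum_j u1 0 j j * piC R j l - \sum_j u0 0 j j * piC R j l + d l.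
  rewrite -sumrB [LHS](bigD1 l) // [in RHS](bigD1 l) //= leqnn /piC ltnn.
  rewrite addrAC mulr0 mulr0 subrr add0r mulr1; congr (_ + _).
  apply: eq_bigr => j hj; rewrite -mulrBl; congr (_ * _).
  by case: ltngtP hj => // /val_inj ->; rewrite eqxx.
by rewrite /d; ring.
Qed.

(* Both diagonals are partial sums of the trace-free diagonal [d], read from
   consecutive starting points; the wrap-around uses that the total is zero. *)
Lemma hdiag_shift : \tr (u0 0) = \tr (u1 0) ->
  shiftmx R n *m hdiag1 = hdiag0 *m shiftmx R n.
Proof.
move=> htr; have hd : \sum_j d j = 0.
  by move: htr; rewrite /d sumrB /mxtrace => ->; rewrite subrr.
(* l < j is the same as l+1 <= j. The last index wraps to 0, where all signs are +1 on one side and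
   -1 on the other, and both sums vanish. *)
have hS l : hdiag0 (ordS l) (ordS l) = hdiag1 l l.
  rewrite hdiag0E hdiag1E; congr (_ * _) => /=.
  have [hl|hl] := ltnP l.+1 n; first by rewrite modn_small.
  have -> : l.+1 = n by have := ltn_ord l; lia.
  rewrite modnn; transitivity (0 : R); first by under eq_bigr do rewrite mulr1.
  transitivity (- \sum_j d j); first by rewrite hd oppr0.
  rewrite -sumrN; apply: eq_bigr => j _.
  by rewrite ifF ?mulrN1 //; have := ltn_ord j; lia.
apply/matrixP => k l; rewrite !mxE [LHS](bigD1 l) // [RHS](bigD1 k) //=.
rewrite !big1 ?addr0; first last.
- by move=> i hi; rewrite (graded_diag graded_hdiag1) ?mulr0.
- by move=> i hi; rewrite (graded_diag graded_hdiag0) ?mul0r 1?eq_sym.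
rewrite [shiftmx _ _ _ _]mxE; case: eqP => [hk|_]; last by rewrite mul0r mulr0.
by rewrite mul1r mulr1 -hS; congr (hdiag0 _ _); exact: val_inj.
Qed.

End DiagonalSplit.

(** The Hamiltonian field is L (A(X L) + B(L X)) - (D(L X) + C(X L)) L, which is the telescoped
    variation L F_m - F_0 L. *)
Lemma hamVF_tangent (R : realType) (m N : nat) (j : nat) (V : 'M[R]_(m, N))
    (tX : int) (X : ser R N) : (0 < j <= m)%N -> in_g tX X ->
  exists W : 'M[R]_(m, N), forall p : int,
    is_derive V W (fun V' : 'M[R]_(m, N) => Lser j V' p) (hamVF 1 tX (Lser j V) X p).
Proof.
move=> hj [hXt hXg]; have hj0 : (0 < j)%N by case/andP: hj.
have hX : gradedS X by [].
pose s := Lids m j; pose ws := map (fac V) s.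
pose u0 := lact ws X; pose u1 := ract ws X.
have gd pre post := gradedS_dressed V hX pre post.
have g0 : graded 0 (u0 0) by exact: (gd [::] s).
have g1 : graded 0 (u1 0) by exact: (gd s [::]).
pose h0 := hdiag0 u0 u1; pose h1 := hdiag1 u0 u1.
(* As the list has no repetition, each index i determines its prefix and suffix, hence the required
   variation of its factor. *)
pose D i := dressed_diff V X h0 h1 (take (index i s) s) i (drop (index i s).+1 s).
have [W hW] : exists W : 'M[R]_(m, N), forall i, (0 < i <= m)%N -> lowmx i W = D i.
  apply: lowmx_surj => i hi; apply: graded_dressed_diff => //.
    exact: graded_hdiag0.
  exact: graded_hdiag1.
exists W => p.
have hh : shiftmx R N *m h1 = h0 *m shiftmx R N.
  by apply: hdiag_shift => //; exact: trace_lact_ract.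
have := is_derive_Lser (X := X) (x := V) (v := W) (Vt := id) (dlow := fun i => lowmx i W)
  hj erefl hh (fun i _ => is_derive_lowmx i V W).
move=> /(_ _ p) H; apply: is_derive_eq; first apply: H.
  move=> pre i post es; rewrite hW; last by rewrite -(mem_Lids i hj) es mem_cat mem_head orbT.
  have ei : index i s = size pre.
    have := uniq_Lids m hj0; rewrite /s es cat_uniq /= negb_or.
    by case/and3P=> _ /andP[hi _] _; rewrite index_cat (negPf hi) /= eqxx addn0.
  rewrite /D ei /s es take_size_cat // -cat_rcons drop_size_cat //.
  by rewrite size_rcons.
have hs1 : sumdeg ws = 1 by exact: sumdeg_Lids.
have a0 : above (1 + tX) u0 by rewrite -hs1; exact: above_lact.
have a1 : above (1 + tX) u1 by rewrite -hs1; exact: above_ract.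
have EL : Lser j V = lact ws (oneS R N) by exact: LserE.
rewrite /hamVF EL.
have lE t u : above t u -> mulS 1 t (lact ws (oneS R N)) u = lact ws u.
  by move=> hu; rewrite -{1}hs1 mulS_lact.
have rE t u : above t u -> mulS t 1 u (lact ws (oneS R N)) = ract ws u.
  by move=> hu; rewrite -{1}hs1 lact_one mulS_ract.
have half_above t (u : ser R N) : above t u -> above t (halfS u).
  by move=> hu q hq; rewrite /halfS hu ?scaler0.
have R0_above t (u : ser R N) : above t u -> above t (R0op u).
  by move=> hu q hq; rewrite /R0op /subS /Pplus /Pminus hu // !if_same subrr.
have P0_above t (u : ser R N) : above t u -> above t (Pzero u).
  by move=> hu q hq; rewrite /Pzero hu // if_same.
have Pi_above t (u : ser R N) : above t u -> above t (PiOp u).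
  move=> hu q hq; rewrite /PiOp; case: eqP => // q0; apply/matrixP => k l; rewrite !mxE.
  by case: eqP => // _; rewrite big1 // => i _; rewrite hu ?mxE ?mul0r // -q0.
have add_above t (u v : ser R N) : above t u -> above t v -> above t (addS u v).
  by move=> hu hv q hq; rewrite /addS hu ?hv ?addr0.
have sub_above t (u v : ser R N) : above t u -> above t v -> above t (subS u v).
  by move=> hu hv q hq; rewrite /subS hu ?hv ?subr0.
rewrite (lE tX X) // (rE tX X) // -/u0 -/u1.
rewrite (lE _ (Aop u1)); last by apply/half_above/add_above; auto.
rewrite (rE _ (Dop u0)); last by apply/half_above/sub_above; auto.
rewrite (lE _ (Bop u0)); last by apply/half_above/sub_above; auto.
rewrite (rE _ (Cop u1)); last by apply/half_above/add_above; auto.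
rewrite -/ws -/u0 -/u1 -/s -Aop_Bop -Dop_Cop lact_addS ract_addS /addS /subS opprD !addrA.
by rewrite [X in X - _]addrAC.
Qed.

(** * Rotations of the list of factors *)

(** Without repetitions, a rotation is determined by its first element. *)
Lemma rot_head (T : eqType) (c : seq T) k x t :
  uniq c -> rot k c = x :: t -> x :: t = rot (index x c) c.
Proof.
move=> cu.
wlog hk : k / (k < size c)%N => [H e|e].
  have [hk|hk] := ltnP k (size c); first exact: H hk e.
  by rewrite rot_oversize // in e; apply: (H 0%N); rewrite ?rot0 ?e.
rewrite -e; congr (rot _ _).
have : nth x (rot k c) 0 = x by rewrite e.
rewrite /rot nth_cat size_drop subn_gt0 hk nth_drop addn0 => {1}<-.
by rewrite index_uniq.
Qed.

Section Rotations.
Variable m : nat.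

Lemma LidsE j : (0 < j)%N -> Lids m j = rev (iota 1 j) ++ rev (iota j.+1 (m - j)).
Proof.
by case: j => // j _; rewrite /Lids [iota 1 _]/= rev_cons cat_rcons.
Qed.

Lemma Lids_rot j : (0 < j <= m)%N -> Lids m j = rot (m - j) (rev (iota 1 m)).
Proof.
move=> hj; rewrite LidsE; last by lia.
have -> : iota 1 m = iota 1 (j + (m - j)) by congr iota; lia.
rewrite iotaD rev_cat add1n.
by rewrite -{2}(size_iota j.+1 (m - j)) -[size _]size_rev rot_size_cat.
Qed.

Lemma rev_iota1S i : rev (iota 1 i.+1) = i.+1 :: rev (iota 1 i).
Proof. by rewrite -[in LHS](addn1 i) iotaD rev_cat /= add1n. Qed.

(** Both lists are rotations of m, ..., 1 that start with i. *)
Lemma Lids_split j pre i post : (0 < j <= m)%N ->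
  Lids m j = pre ++ i :: post -> i :: post ++ pre = Lids m i.
Proof.
move=> hj es; have hi : (0 < i <= m)%N by rewrite -(mem_Lids i hj) es mem_cat mem_head orbT.
have cu : uniq (rev (iota 1 m)) by rewrite rev_uniq iota_uniq.
have := rot_size_cat pre (i :: post); rewrite -es (Lids_rot hj) rot_rot_add.
move=> /(rot_head cu) /= ->; apply/esym.
have := Lids_rot hi; rewrite LidsE; last by lia.
case: i hi {es} => // i hi; rewrite rev_iota1S.
by move=> /esym/(rot_head cu).
Qed.

Definition prevL i := if i == 1%N then m else i.-1.

(** For X = 1, this and [Lids_split] identify the Y just before the factor i with the product L_i
    and the Y just after it with L_(i-1), cyclically. *)
Lemma Lids_prev i post pre : (0 < i <= m)%N ->
  i :: post ++ pre = Lids m i -> post ++ rcons pre i = Lids m (prevL i).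
Proof.
move=> hi; rewrite -rcons_cat -rot1_cons => ->; rewrite !LidsE /prevL; [|by case: eqP; lia|by lia].
case: i hi => // i hi; rewrite rev_iota1S cat_cons rot1_cons eqSS.
case: eqP => [->|hi0] /=.
  by rewrite subnn cats0 -rev_cons; congr rev; case: m hi => // m' _; rewrite subn1.
rewrite rcons_cat -rev_cons; congr (_ ++ rev _).
by have -> : (m - i = (m - i.+1).+1)%N by lia.
Qed.

End Rotations.

(** * The coefficient of lambda^0 in L_j *)

Section LaxDiagonal.
Variables (R : realType) (m N : nat) (V : 'M[R]_(m, N)).

(** Since V_i is I plus a term in lambda^(-1), the top coefficient is kept and the next one sees the
    V_i only to first order. *)
Lemma lact_V_coef s (u : ser R N) : 1%N \notin s -> above 1 u ->
  lact (map (fac V) s) u 1 = u 1 /\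
  lact (map (fac V) s) u 0 = \sum_(a <- s) lowmx a V *m u 1 + u 0.
Proof.
move=> hs hu; elim: s hs => [|i s IH] /=; first by rewrite big_nil add0r.
rewrite inE negb_or eq_sym => /andP[hi hs]; have [IH1 IH0] := IH hs.
rewrite /lmulF /= /facdeg /fachi (negPf hi) !subr0 !mul1mx add0r IH1 IH0.
split; last by rewrite big_cons addrC addrA.
have := above_lact (ws := map (fac V) s) hu; rewrite sumdeg_facs (count_memPn hs) add0r.
by move=> ->; rewrite ?mulmx0 ?addr0.
Qed.

Lemma prodV_coef s : 1%N \notin s ->
  lact (map (fac V) s) (oneS R N) 0 = 1%:M /\
  lact (map (fac V) s) (oneS R N) (-1) = \sum_(a <- s) lowmx a V.
Proof.
elim: s => [|i s IH] /=; first by rewrite big_nil /oneS.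
rewrite inE negb_or eq_sym => /andP[hi hs]; have [IH1 IH0] := IH hs.
rewrite /lmulF /= /facdeg /fachi (negPf hi) !subr0 !mul1mx addNr add0r IH1 IH0 mulmx1.
split; last by rewrite big_cons addrC.
by rewrite (above_facs V hs) // mulmx0 addr0.
Qed.

(** L_j has top degree 1, so its coefficient of lambda^0 takes the lower term of exactly one factor
    and the leading terms of all others. *)
Lemma Lids_coef0 j : (0 < j)%N ->
  lact (map (fac V) (Lids m j)) (oneS R N) 0 =
  \sum_(a <- rev (iota 2 j.-1)) lowmx a V *m shiftmx R N + lowmx 1 V
  + \sum_(a <- rev (iota j.+1 (m - j))) shiftmx R N *m lowmx a V.
Proof.
move=> hj; have h1 : 1%N \notin rev (iota 2 j.-1) by rewrite mem_rev mem_iota.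
have h2 : 1%N \notin rev (iota j.+1 (m - j)) by rewrite mem_rev mem_iota; lia.
rewrite /Lids map_cat lact_cat /=.
set u := lact _ (oneS R N); have [u0 u1] := prodV_coef h2; rewrite -/u in u0 u1.
have au : above 0 u by exact: above_facs.
have [|_ ->] := lact_V_coef h1 (u := lmulF (fac V 1) u).
  by have := above_lmulF (w := fac V 1) au; rewrite addr0.
rewrite /lmulF /= /facdeg /fachi /= subrr u0 mulmx1 au // mulmx0 addr0.
by rewrite sub0r u1 mulmx1 mulmx_sumr -addrA [lowmx 1 V + _]addrC.
Qed.

Lemma low_shiftE a (k : 'I_N) : a != 1%N ->
  (lowmx a V *m shiftmx R N) k k = vrow V a k.
Proof.
move=> /negPf ha; rewrite mxE (bigD1 (ordS k)) //= big1 ?addr0.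
  by rewrite /lowmx ha !mxE /= eqxx mulr1.
by move=> l hl; rewrite /lowmx ha mxE ifN ?mul0r.
Qed.

(** The shift on the left moves row k-1 to row k; hence the factors to the right of U_1 contribute v
    at k-1. *)
Lemma shift_lowE a (k : 'I_N) : a != 1%N ->
  (shiftmx R N *m lowmx a V) k k = vrow V a (ord_pred k).
Proof.
move=> /negPf ha; have e : ((ord_pred k).+1 %% N)%N = k := congr1 val (ord_predK k).
rewrite mxE (bigD1 (ord_pred k)) // big1 ?addr0.
  by rewrite /lowmx ha !mxE e eqxx mul1r /= addr0.
move=> l; rewrite andTb => hl; rewrite !mxE ifN ?mul0r //; apply: contra hl => /eqP el.
by apply/eqP; rewrite -[l]ordSK; congr ord_pred; apply: val_inj.
Qed.

Lemma Lids_diag0 j (k : 'I_N) : (0 < j)%N ->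
  lact (map (fac V) (Lids m j)) (oneS R N) 0 k k =
  \sum_(1 <= a < j.+1) vrow V a k + \sum_(j.+1 <= a < m.+1) vrow V a (ord_pred k).
Proof.
move=> hj; rewrite Lids_coef0 // !mxE !summxE; congr (_ + _).
  rewrite big_ltn // addrC; congr (_ + _); first by rewrite eqxx.
  rewrite (perm_big _ (permEl (perm_rev _))) /index_iota subSS -subn1.
  rewrite big_seq [RHS]big_seq; apply: eq_bigr => a; rewrite mem_iota => ha.
  by rewrite low_shiftE //; lia.
rewrite (perm_big _ (permEl (perm_rev _))) /index_iota subSS.
rewrite big_seq [RHS]big_seq; apply: eq_bigr => a; rewrite mem_iota => ha.
by rewrite shift_lowE //; lia.
Qed.

Lemma low_commE i (Y Y' : 'M[R]_N) k l : graded 0 Y -> graded 0 Y' ->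
  (lowmx i V *m Y - Y' *m lowmx i V) k l =
  if i == 1%N then (if k == l then vrow V 1 k * (Y k k - Y' k k) else 0)
  else (if l == ordS k then vrow V i k * (Y (ordS k) (ordS k) - Y' k k) else 0).
Proof.
move=> gY gY'; rewrite !mxE (bigD1 l) // [X in _ - X](bigD1 k) //= !big1; first last.
- by move=> a ha; rewrite (graded_diag gY) ?mulr0.
- by move=> a ha; rewrite (graded_diag gY') ?mul0r 1?eq_sym.
rewrite !addr0 /lowmx; case: (i == 1%N); rewrite !mxE.
  by case: eqP => [->|_]; [rewrite mulrBr [Y' _ _ * _]mulrC | rewrite mul0r mulr0 subr0].
have -> : ((l : nat) == (k.+1 %% N)%N) = (l == ordS k) by [].
by case: eqP => [->|_]; [rewrite mulrBr [Y' _ _ * _]mulrC | rewrite mul0r mulr0 subr0].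
Qed.

End LaxDiagonal.

(** * The lattice and the Lax equation *)

Section Lattice.
Variables (R : realType) (m N : nat).
Implicit Types z : 'I_(m * N) -> R.

Lemma at_mod_ltn z c (hc : (c < m * N)%N) : at_mod z c = z (Ordinal hc).
Proof.
rewrite /at_mod modn_small //; case: insubP => [i _ ei|]; last by rewrite hc.
by congr z; apply: val_inj.
Qed.

Lemma eq_at_mod z a b : a = b %[mod m * N] -> at_mod z a = at_mod z b.
Proof. by rewrite /at_mod => ->. Qed.

Lemma site_ltn i (k : 'I_N) : (0 < i <= m)%N -> (m * k + i.-1 < m * N)%N.
Proof. by move=> hi; have := ltn_ord k; nia. Qed.

Lemma vrow_Vof z i k : (0 < i <= m)%N -> vrow (Vof z) i k = at_mod z (m * k + i.-1)%N.
Proof.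
move=> hi; have hi' : (i.-1 < m)%N by lia.
by rewrite (_ : i = (Ordinal hi').+1) ?vrowE ?mxE //=; lia.
Qed.

(** Block k-1 lies m sites back; m * N is added so that the subtraction on naturals is not
    truncated. *)
Lemma site_pred (k : 'I_N) c : m * ord_pred k + c = m * k + m * N - m + c %[mod m * N].
Proof.
rewrite /= muln_modr modnDml; congr ((_ + _) %% _)%N.
by have := ltn_ord k; nia.
Qed.

Lemma site_succ (k : 'I_N) c : m * ordS k + c = m * k.+1 + c %[mod m * N].
Proof. by rewrite /= muln_modr modnDml. Qed.

(* The diagonal of the lambda^0-coefficient of L_j is a sum over a window of m
   consecutive lattice sites. *)
Lemma Lids_window z j (k : 'I_N) : (0 < j <= m)%N ->
  lact (map (fac (Vof z)) (Lids m j)) (oneS R N) 0 k k =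
  \sum_(0 <= r < m) at_mod z (m * k + j + m * N - m + r)%N.
Proof.
move=> hj; have hN := ltn_ord k; rewrite Lids_diag0; last by lia.
(* The first m-j sites of the window lie in block k-1, the last j in block k. *)
rewrite [RHS](big_cat_nat (n := (m - j)%N)) //=; last by lia.
rewrite [RHS]addrC; congr (_ + _); last first.
  rewrite -[X in \sum_(X <= _ < _) _]add0n big_addn subSS.
  rewrite big_nat [RHS]big_nat; apply: eq_bigr => r hr; rewrite vrow_Vof; last by lia.
  apply: eq_at_mod; rewrite site_pred; congr (_ %% _)%N; nia.
rewrite -[X in \sum_(X <= _ < _) _]add0n big_addn.
rewrite -[X in _ = \sum_(X <= _ < _) _]add0n [RHS]big_addn subSS subn0 subKn; last by lia.
rewrite big_nat [RHS]big_nat; apply: eq_bigr => r hr; rewrite vrow_Vof; last by lia.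
apply: eq_at_mod; rewrite -[LHS](modnDr _ (m * N)); congr (_ %% _)%N; nia.
Qed.

(** The first window begins at the site of v^(i)_k and the second ends there. The common term
    cancels, leaving m-1 neighbours on each side. *)
Lemma bogo_rhs_window z i (k : 'I_N) : (0 < i <= m)%N ->
  vrow (Vof (bogo_rhs m z)) i k = vrow (Vof z) i k *
  (\sum_(0 <= r < m) at_mod z (m * k + i.-1 + r)%N
   - \sum_(0 <= r < m) at_mod z (m * k + i + m * N - m + r)%N).
Proof.
move=> hi; have m_gt0 : (0 < m)%N by lia.
have hN := ltn_ord k; have hc := site_ltn k hi.
rewrite !vrow_Vof // !(at_mod_ltn _ hc) /bogo_rhs; congr (_ * _).
rewrite [in RHS]big_ltn // [X in _ = _ - X]big_nat_rev [X in _ = _ - X]big_ltn //=.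
have -> : at_mod z (m * k + i + m * N - m + (0 + m - 1))%N = at_mod z (m * k + i.-1 + 0)%N.
  by apply: eq_at_mod; rewrite -[RHS](modnDr _ (m * N)); congr (_ %% _)%N; nia.
rewrite [X in _ = X - _]addrC addrKA; congr (_ - _); rewrite big_nat [RHS]big_nat.
by apply: eq_bigr => r hr; congr (at_mod z _); nia.
Qed.

(** Entrywise this is [bogo_rhs_window]: the window of L_(i-1) at k+1 (for i = 1, of L_m at k)
    begins at the site of v^(i)_k, and that of L_i at k ends there. *)
Lemma lax_low_diff z i : (0 < i <= m)%N ->
  lowmx i (Vof (bogo_rhs m z)) =
  lowmx i (Vof z) *m lact (map (fac (Vof z)) (Lids m (prevL m i))) (oneS R N) 0
  - lact (map (fac (Vof z)) (Lids m i)) (oneS R N) 0 *m lowmx i (Vof z).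
Proof.
move=> hi; have m_gt0 : (0 < m)%N by lia.
have g1 : gradedS (oneS R N).
  by move=> p; rewrite /oneS; case: eqP => [->|_]; [exact: graded_one | exact: graded0].
have g s : graded 0 (lact (map (fac (Vof z)) s) (oneS R N) 0).
  exact: (gradedS_dressed (Vof z) g1 [::] s).
apply/matrixP => k l; rewrite low_commE // /lowmx /prevL.
have hN := ltn_ord k.
case: eqP => [ei|hi1]; rewrite mxE.
  case: eqP => // _; rewrite bogo_rhs_window ?ei //.
  rewrite !Lids_window; [|lia..]; congr (_ * (_ - _)).
  rewrite big_nat [RHS]big_nat; apply: eq_bigr => r hr.
  apply: eq_at_mod; rewrite -[LHS](modnDr _ (m * N)); congr (_ %% _)%N; nia.
have -> : ((l : nat) == (k.+1 %% N)%N) = (l == ordS k) by [].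
case: eqP => // _; rewrite bogo_rhs_window //.
rewrite !Lids_window; [|lia..]; congr (_ * (_ - _)).
rewrite big_nat [RHS]big_nat; apply: eq_bigr => r hr; apply: eq_at_mod.
have -> : (m * ordS k + i.-1 + m * N - m + r = m * ordS k + (i.-1 + m * N - m + r))%N by nia.
rewrite site_succ -[LHS](modnDr _ (m * N)); congr (_ %% _)%N; nia.
Qed.

Lemma lax_equation j (z : R -> 'I_(m * N) -> R) (t : R) : (0 < j <= m)%N ->
  (forall k, is_derive t 1 (fun s : R => z s k) (bogo_rhs m (z t) k)) ->
  forall p, is_derive t 1 (fun s : R => Lser j (Vof (z s)) p)
    (commS 1 1 (Lser j (Vof (z t))) (Rop (Lser j (Vof (z t)))) p).
Proof.
move=> hj hz p; have hj0 : (0 < j)%N by case/andP: hj.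
have hvrow i k : (0 < i <= m)%N -> is_derive t 1 (fun s => vrow (Vof (z s)) i k)
    (vrow (Vof (bogo_rhs m (z t))) i k).
  move=> hi; rewrite vrow_Vof // (at_mod_ltn _ (site_ltn k hi)).
  rewrite (_ : (fun s => _) = fun s => z s (Ordinal (site_ltn k hi))) //.
  by apply: funext => s; rewrite vrow_Vof // (at_mod_ltn _ (site_ltn k hi)).
have hlow i : (0 < i <= m)%N ->
    is_derive t 1 (fun s => lowmx i (Vof (z s))) (lowmx i (Vof (bogo_rhs m (z t)))).
  move=> hi; apply/is_derive_mxP => k l; rewrite /lowmx; case: eqP => [ei|_].
    rewrite mxE (_ : (fun s => _) = fun s => if k == l then vrow (Vof (z s)) 1 k else 0);
      last by apply: funext => s; rewrite mxE.
    by case: eqP => _; [apply: hvrow; lia | exact: is_derive_cst].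
  rewrite mxE (_ : (fun s => _) = fun s => if (l : nat) == (k.+1 %% N)%N
    then vrow (Vof (z s)) i k else 0); last by apply: funext => s; rewrite mxE.
  by case: eqP => _; [exact: hvrow | exact: is_derive_cst].
(* X = 1 with zero diagonal corrections: then F_0 and F_m are both R(L_j). *)
have h00 : shiftmx R N *m 0 = 0 *m shiftmx R N by rewrite mulmx0 mul0mx.
have := is_derive_Lser (X := oneS R N) (Vt := fun s => Vof (z s)) hj erefl h00 hlow.
move=> /(_ _ p) H; apply: is_derive_eq; first apply: H.
  move=> pre i post es.
  have hi : (0 < i <= m)%N by rewrite -(mem_Lids i hj) es mem_cat mem_head orbT.
  have ei := Lids_split hj es.
  rewrite lax_low_diff // -ei -(Lids_prev hi ei) /dressed_diff /dressed /dressing.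
  by rewrite !if_same !addr0 -!lact_one -!lact_cat -!map_cat.
set ws := map _ _; have hs1 : sumdeg ws = 1 by exact: sumdeg_Lids.
have EL : Lser j (Vof (z t)) = lact ws (oneS R N) by exact: LserE.
have aR : above 1 (Rop (lact ws (oneS R N))).
  move=> q hq; have := above_lact (ws := ws) (above_one R N); rewrite hs1 addr0 => a1.
  by rewrite RopE a1 // scaler0 oppr0 if_same.
have Rs u : Rshift u 0 = Rop u by apply: funext => q; rewrite /Rshift if_same addr0.
rewrite /commS EL -{1 4}hs1 mulS_lact //.
by rewrite [X in _ = subS _ (mulS _ _ _ X) _]lact_one -hs1 mulS_ract ?hs1 // !Rs -lact_one.
Qed.

End Lattice.

(** * Evaluation and determinants *)

Section Evaluation.
Variables (R : realType) (n : nat).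
Implicit Types (u : ser R n) (w : factor R n) (ws : seq (factor R n)).

Lemma sumdeg_cons w ws : sumdeg (w :: ws) = fdeg w + sumdeg ws.
Proof. exact: big_cons. Qed.

Lemma lact_below ws p : p < sumdeg ws - (size ws)%:Z -> lact ws (oneS R n) p = 0.
Proof.
elim: ws p => [|w ws IH] p.
  by rewrite /sumdeg big_nil /= /oneS => hp; case: eqP => // e; lia.
rewrite sumdeg_cons /=; move: (sumdeg ws) IH => S IH hp.
by rewrite /lmulF !IH ?mulmx0 ?addr0 //; lia.
Qed.

Variable x : R.
Hypothesis x_neq0 : x != 0.

Definition evalF w : 'M[R]_n := x ^ fdeg w *: fhi w + x ^ (fdeg w - 1) *: flo w.
Definition eval_prod ws : 'M[R]_n := foldr (fun w A => evalF w *m A) 1%:M ws.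
Definition evalN (k : nat) (lo : int) u : 'M[R]_n :=
  \sum_(i < k) x ^ (lo + i%:Z) *: u (lo + i%:Z).

(** A factor lengthens the range of powers by one; the two vanishing conditions remove the terms of
    u just outside its range. *)
Lemma evalN_lmulF k lo w u : u (lo - 1) = 0 -> u (lo + k%:Z) = 0 ->
  evalN k.+1 (fdeg w + lo - 1) (lmulF w u) = evalF w *m evalN k lo u.
Proof.
move=> ulo uhi; rewrite /evalN /lmulF.
under eq_bigr do rewrite scalerDr.
rewrite big_split /= /evalF mulmxDl; congr (_ + _).
  rewrite big_ord_recl /= (_ : fdeg w + lo - 1 + 0%Z - fdeg w = lo - 1); last by lia.
  rewrite ulo mulmx0 scaler0 add0r mulmx_sumr; apply: eq_bigr => i _.
  rewrite -scalemxAl -scalemxAr scalerA -expfzDr //.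
  congr (x ^ _ *: (_ *m u _)); rewrite /bump /=; lia.
rewrite big_ord_recr /= (_ : fdeg w + lo - 1 + k%:Z - fdeg w + 1 = lo + k%:Z); last by lia.
rewrite uhi mulmx0 scaler0 addr0 mulmx_sumr; apply: eq_bigr => i _.
rewrite -scalemxAl -scalemxAr scalerA -expfzDr //.
congr (x ^ _ *: (_ *m u _)); lia.
Qed.

Lemma evalN_lact ws :
  evalN (size ws).+1 (sumdeg ws - (size ws)%:Z) (lact ws (oneS R n)) = eval_prod ws.
Proof.
elim: ws => [|w ws IH].
  by rewrite /sumdeg big_nil /evalN big_ord_recl big_ord0 /= expr0z scale1r addr0.
have hb := lact_below (ws := ws).
have := above_lact (ws := ws) (above_one R n); rewrite addr0 => ha.
rewrite sumdeg_cons /= -IH -evalN_lmulF; move: (sumdeg ws) ha hb => S ha hb.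
- by congr (evalN _ _ _); lia.
- by apply: hb; lia.
by apply: ha; lia.
Qed.

Lemma eval_prod_cat ws ws' : eval_prod (ws ++ ws') = eval_prod ws *m eval_prod ws'.
Proof. by elim: ws => [|w ws IH] /=; rewrite ?mul1mx // IH mulmxA. Qed.

End Evaluation.

Lemma size_Lids m j : (0 < j <= m)%N -> size (Lids m j) = m.
Proof. by move=> hj; rewrite size_cat /= !size_rev !size_iota; lia. Qed.

Lemma LevalE (R : realType) (m N j : nat) (V : 'M[R]_(m, N)) (y : R) :
  (0 < j <= m)%N -> y != 0 -> Leval j V y = eval_prod y (map (fac V) (Lids m j)).
Proof.
move=> hj hy; set ws := map _ _.
have hs : size ws = m by rewrite size_map size_Lids.
have hd : sumdeg ws = 1 by exact: sumdeg_Lids.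
have EL : Lser j V = lact ws (oneS R N) by apply: LserE; lia.
rewrite -evalN_lact // hs hd /Leval /evalS EL.
have -> : (absz (1 - - m%:Z)%R).+1 = m.+2 by lia.
(* [Leval] starts at the power -m, one below the lowest possible power 1-m; the extra term is
   zero. *)
rewrite big_ord_recl /= lact_below ?hs ?hd ?scaler0 ?add0r; last by lia.
apply: eq_bigr => i _; rewrite /bump /=.
by have -> : - m%:Z + (1 + i)%N%:Z = 1 - m%:Z + i%:Z by lia.
Qed.

Section DetCommute.
Variables (F : fieldType) (n : nat).

(** For mu = 0 the determinant is multiplicative. Otherwise the block matrix K is made triangular by
    eliminating B, once by column and once by row operations. *)
Lemma det_mulmxC_sub (A B : 'M[F]_n) (mu : F) :
  \det (A *m B - mu%:M) = \det (B *m A - mu%:M).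
Proof.
suff H : \det (mu%:M - A *m B) = \det (mu%:M - B *m A).
  have E (C : 'M[F]_n) : \det (C - mu%:M) = (-1) ^+ n * \det (mu%:M - C).
    by rewrite -[C - _]opprB -[- (mu%:M - C)]scaleN1r detZ.
  by rewrite !E H.
have [->|mu0] := eqVneq mu 0.
  by rewrite raddf0 !sub0r -!scaleN1r !detZ !det_mulmx [\det A * _]mulrC.
pose K := block_mx mu%:M A B 1%:M.
have E1 : K *m block_mx 1%:M 0 (- B) 1%:M = block_mx (mu%:M - A *m B) A 0 1%:M.
  by rewrite mulmx_block !mulmx1 !mul1mx !mulmx0 !add0r mulmxN subrr.
have E2 : block_mx 1%:M 0 (- (mu^-1 *: B)) 1%:M *m K
    = block_mx mu%:M A 0 (1%:M - mu^-1 *: (B *m A)).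
  rewrite mulmx_block !mul1mx !mul0mx !addr0 !mulNmx mul_mx_scalar scalerA divff //.
  by rewrite scale1r addNr -scalemxAl [1%:M - _]addrC.
transitivity (\det K).
  have := congr1 determinant E1.
  by rewrite det_mulmx det_lblock det_ublock !det1 !mulr1.
have := congr1 determinant E2.
rewrite det_mulmx det_lblock det_ublock !det1 !mul1r => ->.
by rewrite det_scalar -detZ scalerBr scalemx1 scalerA divff // scale1r.
Qed.
End DetCommute.

Section BlockStack.
Variables (R : comNzRingType) (N p : nat).

Fixpoint colstack (n : nat) (J : nat -> 'M[R]_(N, p)) : 'M[R]_(n * N, p) :=
  if n is n'.+1 then col_mx (J 0%N) (colstack n' (J \o succn)) else 0.

Fixpoint blockdiag (n : nat) (B : nat -> 'M[R]_N) : 'M[R]_(n * N) :=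
  if n is n'.+1 then block_mx (B 0%N) 0 0 (blockdiag n' (B \o succn)) else 0.

Lemma eq_colstack n J J' : (forall a, (a < n)%N -> J a = J' a) ->
  colstack n J = colstack n J'.
Proof.
elim: n J J' => //= n IH J J' h.
by rewrite h // (IH _ (J' \o succn)) // => a ha; exact: h.
Qed.

Lemma colstack_mul n J (A : 'M[R]_p) : colstack n J *m A = colstack n (fun a => J a *m A).
Proof.
by elim: n J => [|n IH] J /=; rewrite ?mul0mx // mul_col_mx IH.
Qed.

Lemma blockdiag_colstack n B J :
  blockdiag n B *m colstack n J = colstack n (fun a => B a *m J a).
Proof.
elim: n B J => [|n IH] B J /=; rewrite ?mulmx0 //.
by rewrite mul_block_col !mul0mx addr0 add0r IH.
Qed.

Lemma det_blockdiag n B : \det (blockdiag n B) = \prod_(a < n) \det (B a).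
Proof.
elim: n B => [|n IH] B /=; first by rewrite big_ord0 det_mx00.
by rewrite det_ublock IH big_ord_recl.
Qed.

Lemma colstack_mul0 n J q (A : 'M[R]_(p, q)) : (forall a, (a < n)%N -> J a *m A = 0) ->
  colstack n J *m A = 0.
Proof.
elim: n J => [|n IH] J h /=; first by rewrite mul0mx.
rewrite mul_col_mx h // IH ?col_mx0 // => a ha; exact: h.
Qed.

Lemma colstack_orth n J :
  (forall a b, (a < n)%N -> (b < n)%N -> J a *m (J b)^T = if a == b then 1%:M else 0) ->
  colstack n J *m (colstack n J)^T = 1%:M.
Proof.
elim: n J => [|n IH] J h /=; first by apply/matrixP => -[].
have C0 : colstack n (J \o succn) *m (J 0%N)^T = 0.
  by apply: colstack_mul0 => a ha; rewrite /= h.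
rewrite tr_col_mx mul_col_row C0 h // IH; last by move=> a b ha hb; rewrite /= h.
rewrite -[J 0%N *m _]trmxK trmx_mul trmxK C0 trmx0.
by rewrite -scalar_mx_block.
Qed.

End BlockStack.

(** * The spectral identity *)

Section Spectral.
Variables (R : realType) (m N : nat).
Hypothesis m_gt0 : (0 < m)%N.
Variables (z : 'I_(m * N) -> R) (x : R).
Hypothesis x_neq0 : x != 0.

(** Selects the rows m k + i - 1 at which z is v^(i)_k. Stacked for i = 1, ..., m, these selections
    form a permutation matrix. *)
Definition rowsel (i : nat) : 'M[R]_(N, m * N) :=
  \matrix_(k, c) (if (c : nat) == (m * k + i.-1)%N then 1 else 0).

Let E i := evalF (x ^+ m) (fac (Vof z) i).
Let T := Tmat m z x.

Lemma rowsel_mul i (A : 'M[R]_(m * N)) k l (hi : (0 < i <= m)%N) :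
  (rowsel i *m A) k l = A (Ordinal (site_ltn k hi)) l.
Proof.
rewrite mxE (bigD1 (Ordinal (site_ltn k hi))) //= big1 ?addr0 ?mxE /= ?eqxx ?mul1r //.
by move=> c hc; rewrite mxE ifN ?mul0r.
Qed.

Lemma lowmx_mul i (p : nat) (A : 'M[R]_(N, p)) k l :
  (lowmx i (Vof z) *m A) k l =
  vrow (Vof z) i k * A (if i == 1%N then k else ordS k) l.
Proof.
rewrite /lowmx mxE; case: eqP => [->|_].
  rewrite (bigD1 k) //= big1 ?addr0 ?mxE ?eqxx // => c hc.
  by rewrite mxE ifN ?mul0r // eq_sym.
rewrite (bigD1 (ordS k)) //= big1 ?addr0 ?mxE /= ?eqxx // => c hc.
by rewrite mxE ifN ?mul0r.
Qed.

Lemma shiftmx_mul (p : nat) (A : 'M[R]_(N, p)) k l :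
  (shiftmx R N *m A) k l = A (ord_pred k) l.
Proof.
have e : ((ord_pred k).+1 %% N)%N = k := congr1 val (ord_predK k).
rewrite mxE (bigD1 (ord_pred k)) // big1.
  by rewrite mxE e eqxx mul1r /= addr0.
move=> c; rewrite andTb => hc; rewrite mxE ifN ?mul0r //; apply: contra hc => /eqP ec.
by apply/eqP; rewrite -[c]ordSK; congr ord_pred; apply: val_inj.
Qed.

Lemma xm_neq0 : x ^+ m != 0.
Proof. exact: expf_neq0. Qed.

(** Row class i of T meets only class i-1: in the same block through the lower shift, and in the
    next block through z. The scalar fits since x x^(-m) = x^(1-m). *)
Lemma rowsel_T i : (1 < i <= m)%N -> rowsel i *m T = x *: (E i *m rowsel i.-1).
Proof.
move=> hi; have hi0 : (0 < i <= m)%N by lia.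
have hi1 : (i == 1%N) = false by lia.
apply/matrixP => k l; rewrite (rowsel_mul _ _ _ hi0) /E /evalF /= /facdeg /fachi hi1.
rewrite expr0z scale1r sub0r mulmxDl mul1mx -scalemxAl.
rewrite [RHS]mxE [X in _ = _ * X]mxE [X in _ = _ * (_ + X)]mxE lowmx_mul hi1 !mxE /=.
have hk := ltn_ord k; have hl := ltn_ord l.
rewrite addrC mulrDr; congr (_ + _).
  have -> : (m * k + i.-1 == l.+1 %% (m * N))%N = ((l : nat) == (m * k + i.-1.-1)%N).
    have [hl1|hl1] := ltnP l.+1 (m * N); first by rewrite modn_small //; lia.
    have -> : l.+1 = (m * N)%N by lia.
    by rewrite modnn; apply/eqP/eqP; nia.
  by case: eqP; rewrite ?mulr1 ?mulr0.
have -> : ((m * k + i.-1 + m.-1) %% (m * N) = m * (k.+1 %% N) + i.-1.-1)%N.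
  have -> : (m * k + i.-1 + m.-1 = m * k.+1 + i.-1.-1)%N by nia.
  have [hk1|hk1] := ltnP k.+1 N; first by rewrite !modn_small //; nia.
  have -> : k.+1 = N by lia.
  by rewrite modnn modnDl modn_small; nia.
case: eqP => _; last by rewrite !mulr0.
rewrite mulr1 vrow_Vof // (at_mod_ltn _ (site_ltn k hi0)) mulrA; congr (_ * _).
rewrite -[(x ^+ m) ^ (-1)]/((x ^+ m)^-1) -(prednK m_gt0) exprS invfM mulrA divff //.
by rewrite mul1r.
Qed.

(** From class 1 the lower shift leads to class m of the previous block, which is the shift in U_1;
    here x^(1-m) x^m = x. *)
Lemma rowsel_T1 : rowsel 1 *m T = x ^- m.-1 *: (E 1 *m rowsel m).
Proof.
have h1 : (0 < 1 <= m)%N by [].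
apply/matrixP => k l; rewrite (rowsel_mul _ _ _ h1) /E /evalF /= /facdeg /fachi /=.
rewrite expr1z subrr expr0z scale1r mulmxDl -scalemxAl.
rewrite [RHS]mxE [X in _ = _ * X]mxE [X in _ = _ * (X + _)]mxE lowmx_mul shiftmx_mul !mxE /=.
have hk := ltn_ord k; have hl := ltn_ord l.
rewrite addrC mulrDr; congr (_ + _).
  have -> : (m * k + 0 == l.+1 %% (m * N))%N =
      ((l : nat) == (m * ((k + N).-1 %% N) + m.-1)%N).
    have -> : ((k + N).-1 %% N = if k == 0%N :> nat then N.-1 else k.-1)%N.
      case: eqP => [->|k0]; first by rewrite modn_small; lia.
      have -> : ((k + N).-1 = k.-1 + N)%N by lia.
      by rewrite modnDr modn_small; lia.
    have eN : (m * N.-1 + m = m * N)%N by rewrite -mulnSr prednK //; lia.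
    have ek : k != 0%N :> nat -> (m * k.-1 + m = m * k)%N.
      by move=> k0; rewrite -mulnSr prednK //; lia.
    have mk : (m <= m * k)%N || (k == 0%N :> nat).
      by case: (k : nat) => [|k']; rewrite ?orbT // leq_pmulr.
    have mkN : (m * k <= m * N.-1)%N by rewrite leq_mul2l; lia.
    have [hl1|hl1] := ltnP l.+1 (m * N).
      by rewrite modn_small //; case: ifP => [/eqP ->|/negbT/ek k0]; apply/eqP/eqP; lia.
    have -> : l.+1 = (m * N)%N by lia.
    by rewrite modnn; case: ifP => [/eqP ->|/negbT/ek k0]; apply/eqP/eqP; lia.
  case: eqP => _; last by rewrite !mulr0.
  by rewrite mulr1 -{2}(prednK m_gt0) exprSr mulrA mulVf ?mul1r // expf_neq0.
have -> : ((m * k + 0 + m.-1) %% (m * N) = m * k + m.-1)%N by rewrite modn_small; nia.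
case: eqP => _; last by rewrite !mulr0.
by rewrite mulr1 vrow_Vof // (at_mod_ltn _ (site_ltn k h1)).
Qed.

Lemma rowsel_Texp i n : (0 < i)%N -> (i + n <= m)%N ->
  rowsel (i + n) *m T ^+ n
  = x ^+ n *: (eval_prod (x ^+ m) (map (fac (Vof z)) (rev (iota i.+1 n))) *m rowsel i).
Proof.
move=> hi; elim: n => [|n IH] hn.
  by rewrite addn0 !expr0 scale1r mul1mx mulmx1.
have -> : rev (iota i.+1 n.+1) = (i + n.+1)%N :: rev (iota i.+1 n).
  by rewrite -[in LHS](addn1 n) iotaD rev_cat /= addSnnS.
rewrite exprS -mulmxE mulmxA rowsel_T; last by lia.
rewrite addnS /= -scalemxAl -mulmxA IH; last by lia.
by rewrite -scalemxAr scalerA -exprS -mulmxA.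
Qed.

(** The m steps through the classes j, ..., 1, m, ..., j+1 collect the factors of L_j in order. *)
Lemma rowsel_Tm j : (0 < j <= m)%N ->
  rowsel j *m T ^+ m = Leval j (Vof z) (x ^+ m) *m rowsel j.
Proof.
move=> hj; rewrite LevalE ?xm_neq0 // /Lids map_cat eval_prod_cat /=.
have -> : T ^+ m = T ^+ j.-1 *m T *m T ^+ (m - j).
  by rewrite !mulmxE -exprSr -exprD; congr (_ ^+ _); lia.
have := @rowsel_Texp 1 j.-1 isT; rewrite add1n prednK; last by lia.
move=> H1; rewrite !mulmxA H1; last by lia.
rewrite -scalemxAl -mulmxA rowsel_T1 -!scalemxAr -!scalemxAl.
have := @rowsel_Texp j (m - j); rewrite subnKC; last by lia.
move=> H2; rewrite -!mulmxA H2; [|lia..].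
rewrite -!scalemxAr !scalerA.
(* The m-1 factors x from the V_i cancel the x^(1-m) from U_1. *)
have -> : x ^+ j.-1 / x ^+ m.-1 * x ^+ (m - j) = 1.
  rewrite mulrAC -exprD (_ : (j.-1 + (m - j) = m.-1)%N); last by lia.
  by rewrite divff // expf_neq0.
by rewrite scale1r !mulmxA.
Qed.

Lemma rowsel_orth a b : (a < m)%N -> (b < m)%N ->
  rowsel a.+1 *m (rowsel b.+1)^T = if a == b then 1%:M else 0.
Proof.
move=> ha hb; have ha' : (0 < a.+1 <= m)%N by [].
apply/matrixP => k l; rewrite mxE (bigD1 (Ordinal (site_ltn k ha'))) //= big1 ?addr0.
  rewrite !mxE /= eqxx mul1r.
  have -> : (m * k + a == m * l + b)%N = (a == b) && (k == l).
    apply/eqP/andP => [e|[/eqP-> /eqP->] //].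
    have e' : k = l by apply: val_inj => /=; have := congr1 (divn^~ m) e;
      rewrite ![(m * _)%N]mulnC !divnMDl // !divn_small // !addn0.
    by rewrite e' eqxx; split=> //; apply/eqP; move: e; rewrite e'; lia.
  by case: (a == b); rewrite !mxE //=; case: eqP.
by move=> c hc; rewrite mxE ifN ?mul0r.
Qed.

Lemma det_Tm mu : \det (T ^+ m - mu%:M) =
  \prod_(1 <= j < m.+1) \det (Leval j (Vof z) (x ^+ m) - mu%:M).
Proof.
pose P : 'M[R]_(m * N) := colstack m (fun a => rowsel a.+1).
pose B a := Leval a.+1 (Vof z) (x ^+ m) - mu%:M.
have PP : P *m P^T = 1%:M by apply: colstack_orth; exact: rowsel_orth.
have detP : \det P != 0.
  apply/eqP => P0; have := congr1 determinant PP.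
  by rewrite det_mulmx P0 mul0r det1 => /esym/eqP; rewrite oner_eq0.
(* P intertwines T^m with the block diagonal matrix of the L_j; [det P] is nonzero and cancels from
   the determinants. *)
have EP : P *m (T ^+ m - mu%:M) = blockdiag m B *m P.
  rewrite colstack_mul blockdiag_colstack; apply: eq_colstack => a ha.
  by rewrite mulmxBr mulmxBl rowsel_Tm // mul_mx_scalar mul_scalar_mx.
have := congr1 determinant EP; rewrite !det_mulmx mulrC => /(mulIf detP) ->.
by rewrite det_blockdiag big_add1 big_mkord.
Qed.

(** L_j is (V_j ... V_2 U_1)(V_m ... V_(j+1)); exchanging the two halves gives L_m. *)
Lemma det_Leval_eq mu j : (0 < j <= m)%N ->
  \det (Leval j (Vof z) (x ^+ m) - mu%:M) = \det (Leval m (Vof z) (x ^+ m) - mu%:M).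
Proof.
move=> hj; rewrite !LevalE ?xm_neq0 //; last by lia.
rewrite !LidsE; [|lia..]; rewrite subnn cats0 map_cat eval_prod_cat det_mulmxC_sub.
rewrite -eval_prod_cat -map_cat -rev_cat.
by rewrite -[j.+1]add1n -iotaD subnKC //; lia.
Qed.

End Spectral.

Theorem theorem2 (R : realType) (m N : nat) (hm : (2 <= m)%N) (hN : (2 <= N)%N) :
  (* (1) each family {L_j(v)} is a Poisson submanifold of (g, PB(A,B,C,D)):  *)
  (*     every Hamiltonian vector field at L_j(v) is tangent to the family. *)
  (forall j : nat, (1 <= j <= m)%N ->
     forall (V : 'M[R]_(m, N)) (tX : int) (X : ser R N), in_g tX X ->
       exists W : 'M[R]_(m, N), forall p : int,
         is_derive V W (fun V' : 'M[R]_(m, N) => Lser j V' p)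
                   (hamVF 1 tX (Lser j V) X p))
  /\
  (* (2) along solutions of the lattice, d/dt L_j = [L_j, R(L_j)]. *)
  (forall j : nat, (1 <= j <= m)%N ->
     forall (I : set R) (z : R -> 'I_(m * N) -> R),
       open (I : set R^o) ->
       (forall t : R, I t -> forall k : 'I_(m * N),
          is_derive t 1 (fun s : R => z s k) (bogo_rhs m (z t) k)) ->
       forall t : R, I t -> forall p : int,
         is_derive t 1 (fun s : R => Lser j (Vof (z s)) p)
                   (commS 1 1 (Lser j (Vof (z t))) (Rop (Lser j (Vof (z t)))) p))
  /\
  (* (3) det(T^m - mu I_M) = prod_j det(L_j(lambda^m) - mu I_N), all factors equal. *)
  (forall (z : 'I_(m * N) -> R) (x mu : R), x != 0 ->
     \det ((Tmat m z x) ^+ m - mu%:M)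
       = \prod_(1 <= j < m.+1) \det (Leval j (Vof z) (x ^+ m) - mu%:M)
     /\ (forall j j' : nat, (1 <= j <= m)%N -> (1 <= j' <= m)%N ->
           \det (Leval j (Vof z) (x ^+ m) - mu%:M)
             = \det (Leval j' (Vof z) (x ^+ m) - mu%:M))).
Proof.
have m_gt0 : (0 < m)%N by exact: ltnW.
split; [|split].
- by move=> j hj V tX X hX; exact: hamVF_tangent.
- by move=> j hj I z _ hz t It p; apply: lax_equation => //; exact: hz.
move=> z x mu hx; split; first exact: det_Tm.
by move=> j j' hj hj'; rewrite !(det_Leval_eq m_gt0 z hx mu).
Qed.
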